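(* Let $F$ and $G$ be Hilbert spaces, let $\mathcal{A}\subset\mathscr{B}(F)$ and $\mathcal{B}\subset\mathscr{B}(G)$ be von Neumann algebras, and let $f\in F$ and $g\in G$ be unit vectors with vector states $\varphi_f=\langle f,\bullet f\rangle$ and $\varphi_g=\langle g,\bullet g\rangle$. Suppose that $S\colon\mathcal{A}\rightarrow\mathcal{B}$ is a normal unital completely positive map with $\varphi_f=\varphi_g\circ S$ on $\mathcal{A}$, where $f$ is cyclic for $\mathcal{A}$ and $g$ is cyclic for the commutant $\mathcal{B}'$. Then there exists a normal unital completely positive map $Z\colon\mathscr{B}(F)\rightarrow\mathscr{B}(G)$ that extends $S$, i.e. $Z(a)=S(a)$ for all $a\in\mathcal{A}$, and satisfies $\varphi_f=\varphi_g\circ Z$ on $\mathscr{B}(F)$.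
   Context: $\mathscr{B}(F)$ denotes the bounded operators on $F$; von Neumann algebras $\mathcal{A}\subset\mathscr{B}(F)$ act non-degenerately (so they contain the identity operator). $\mathcal{B}'$ is the commutant of $\mathcal{B}$ in $\mathscr{B}(G)$. A vector $f\in F$ is cyclic for $\mathcal{A}$ if $\overline{\mathcal{A}f}=F$. *)

(* Defs.v *)
From HB Require Import structures.
From mathcomp Require Import all_boot all_order all_algebra.
From mathcomp Require Import complex.
From mathcomp Require Import all_classical all_reals all_analysis.

Set Implicit Arguments.
Unset Strict Implicit.
Unset Printing Implicit Defensive.
Import Order.TTheory GRing.Theory Num.Theory.
Import numFieldNormedType.Exports.
Local Open Scope classical_set_scope.
Local Open Scope ring_scope.

(* The standard topology of R[i], as numFieldNormedType.Exports provides it for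
   variables of type numFieldType. *)
#[non_forgetful_inheritance]
HB.instance Definition _ (R : rcfType) := PseudoPointedMetric.copy R[i] R[i]^o.
#[non_forgetful_inheritance]
HB.instance Definition _ (R : rcfType) := GRing.ComAlgebra.copy R[i] R[i]^o.
#[non_forgetful_inheritance]
HB.instance Definition _ (R : rcfType) := Vector.copy R[i] R[i]^o.
#[non_forgetful_inheritance]
HB.instance Definition _ (R : rcfType) := NormedModule.copy R[i] R[i]^o.

(* A complex Hilbert space.  The inner product is linear in its second
   argument.  As in every normed module over R[i], norms are (real) elements
   of R[i]; positive definiteness of the inner product follows from
   [norm_inner]. *)
HB.mixin Record CompleteNormedModule_isHilbert (R : realType) H
    of CompleteNormedModule R[i] H := {
  inner : H -> H -> R[i];
  inner_linear : forall (x : H) (k : R[i]) (y z : H),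
    inner x (k *: y + z) = k * inner x y + inner x z;
  innerC : forall x y : H, inner y x = Num.conj (inner x y);
  norm_inner : forall x : H, `|x| ^+ 2 = inner x x
}.

#[short(type="hilbertType")]
HB.structure Definition Hilbert (R : realType) :=
  {H of CompleteNormedModule_isHilbert R H & CompleteNormedModule R[i] H}.

Notation "'[ x , y ]" := (inner x y) : ring_scope.

Section BoundedOperators.
Context {R : realType} {F : hilbertType R}.

Definition bounded_operator (T : F -> F) : Prop :=
  linear T /\ exists M : R[i], forall x, `|T x| <= M * `|x|.

Definition bounded_operator_pred : {pred F -> F} :=
  fun T => `[< bounded_operator T >].

Lemma bounded_operator_submod : submod_closed bounded_operator_pred.
Proof.
split.
  apply/asboolP; split=> [k x y|]; first by rewrite scaler0 addr0.
  by exists 0 => x; rewrite normr0 mul0r.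
move=> k S T /asboolP[Sl [M SM]] /asboolP[Tl [N TN]]; apply/asboolP; split.
  move=> c x y; rewrite !fctE Sl Tl !scalerDr addrACA.
  by congr (_ + _ + _); rewrite !scalerA mulrC.
exists (`|k| * M + N) => x; rewrite !fctE mulrDl.
rewrite (le_trans (ler_normD _ _))// lerD// normrZ -mulrA.
by rewrite ler_wpM2l.
Qed.

HB.instance Definition _ :=
  GRing.isSubmodClosed.Build R[i] (F -> F) bounded_operator_pred
    bounded_operator_submod.

End BoundedOperators.

Record bop (R : realType) (F : hilbertType R) := Bop {
  bop_fun :> F -> F;
  bop_funP : bop_fun \in bounded_operator_pred }.

Notation "''B' ( F )" := (bop F) (at level 8, format "''B' ( F )").

Section BopStructure.
Context {R : realType} {F : hilbertType R}.

HB.instance Definition _ := [isSub for @bop_fun R F].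
HB.instance Definition _ := [Choice of 'B(F) by <:].
HB.instance Definition _ := [SubChoice_isSubLmodule of 'B(F) by <:].

Lemma bop_one_subproof : (id : F -> F) \in bounded_operator_pred.
Proof. by apply/asboolP; split=> //; exists 1 => x; rewrite mul1r. Qed.

Definition bop_one : 'B(F) := Bop bop_one_subproof.

Lemma bop_mul_subproof (S T : 'B(F)) : (S \o T) \in bounded_operator_pred.
Proof.
have /asboolP[Sl [M SM]] := bop_funP S; have /asboolP[Tl [N TN]] := bop_funP T.
apply/asboolP; split=> [k x y|]; first by rewrite /= Tl Sl.
exists (`|M| * N) => x /=; rewrite -mulrA.
have [->|T0] := eqVneq (T x) 0.
  have := SM 0; have -> : S 0 = 0 by have := Sl (-1) 0 0; rewrite !scaleN1r !addNr.
  by move=> _; rewrite normr0 mulr_ge0// (le_trans _ (TN x)).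
rewrite (le_trans (SM _))// (@le_trans _ _ (`|M| * `|T x|)) ?ler_wpM2l//.
rewrite ler_pM2r ?normr_gt0//.
have : 0 <= M * `|T x| by rewrite (le_trans _ (SM _)).
by rewrite pmulr_lge0 ?normr_gt0// => /ger0_norm ->.
Qed.

Definition bop_mul (S T : 'B(F)) : 'B(F) := Bop (bop_mul_subproof S T).

Definition is_adjoint (T U : 'B(F)) : Prop :=
  forall x y : F, '[U x, y] = '[x, T y].

Definition vector_state (f : F) (T : 'B(F)) : R[i] := '[f, T f].

Definition commutant (A : set 'B(F)) : set 'B(F) :=
  [set T | forall a, A a -> bop_mul T a = bop_mul a T].

Definition cyclic_vector (A : set 'B(F)) (f : F) : Prop :=
  closure [set a f | a in A] = [set: F].

End BopStructure.

Section OperatorTopologies.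
Context {R : realType}.
Variable F : hilbertType R.

Definition weak_eval (T : 'B(F)) : {ptws F * F -> R[i]} :=
  fun xy => '[xy.1, T xy.2].

(* the weak operator topology *)
Definition weak_bop : Type := initial_topology weak_eval.
HB.instance Definition _ := Topological.on weak_bop.

Definition square_summable (x : nat -> F) : Prop :=
  cvgn (series (fun n => `|x n| ^+ 2 : R[i])).

Definition l2_seq := {x : nat -> F | square_summable x}.

Definition sigma_weak_eval (T : 'B(F)) : {ptws l2_seq * l2_seq -> R[i]} :=
  fun xy => limn (series (fun n => '[sval xy.1 n, T (sval xy.2 n)])).

(* the sigma-weak (ultraweak) topology *)
Definition sigma_weak_bop : Type := initial_topology sigma_weak_eval.
HB.instance Definition _ := Topological.on sigma_weak_bop.

End OperatorTopologies.

Record von_neumann_algebra (R : realType) (F : hilbertType R)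
    (A : set 'B(F)) : Prop := VonNeumannAlgebra {
  vna_one : A bop_one;
  vna_linear : forall (k : R[i]) a b, A a -> A b -> A (k *: a + b);
  vna_mul : forall a b, A a -> A b -> A (bop_mul a b);
  vna_adjoint : forall a, A a -> exists2 b, A b & is_adjoint a b;
  vna_closed : closed (A : set (weak_bop F)) }.

(* The matrix a of operators, acting on the direct sum of n copies of F, is a
   positive operator. *)
Definition positive_bop_mx (R : realType) (F : hilbertType R) n
    (a : 'M['B(F)]_n) : Prop :=
  forall x : 'I_n -> F, 0 <= \sum_i \sum_j '[x i, a i j (x j)].

Section Maps.
Context {R : realType} {F G : hilbertType R}.
Implicit Types (A : set 'B(F)) (B : set 'B(G)) (S : 'B(F) -> 'B(G)).

Definition completely_positive_on A S : Prop :=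
  forall n (a : 'M['B(F)]_n), (forall i j, A (a i j)) ->
    positive_bop_mx a -> positive_bop_mx (map_mx S a).

Definition normal_on A S : Prop :=
  {within (A : set (sigma_weak_bop F)),
    continuous (S : sigma_weak_bop F -> sigma_weak_bop G)}.

(* A map A -> B is represented by a function on 'B(F) of which only the values
   on A matter. *)
Record normal_ucp A B S : Prop := NormalUCP {
  nucp_to : forall a, A a -> B (S a);
  nucp_linear : forall (k : R[i]) a b, A a -> A b ->
    S (k *: a + b) = k *: S a + S b;
  nucp_unital : S bop_one = bop_one;
  nucp_cp : completely_positive_on A S;
  nucp_normal : normal_on A S }.

End Maps.

(* Main.v *)
Require Import Defs.
From mathcomp Require Import all_boot all_order all_algebra.
From mathcomp Require Import complex.
From mathcomp Require Import all_classical all_reals all_analysis.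
From mathcomp Require Import ring.

Set Implicit Arguments.
Unset Strict Implicit.
Unset Printing Implicit Defensive.
Import Order.TTheory GRing.Theory Num.Theory.
Import numFieldNormedType.Exports.
Local Open Scope classical_set_scope.
Local Open Scope ring_scope.

(** The extension [Z] is built in Kraus form, as a sum of maps
    [T |-> K^* T K] with operators [K : G -> F].  Every such sum is normal and
    completely positive on all of ['B(F)] once its finite parts are uniformly
    bounded, so it suffices to find a family of operators whose sum restricts
    to [S] on [A] and has the right state.

    Write [<x, y>_r] for the semi-inner product that a completely positive [r]
    on [A] induces on [A] tensor [G]; its values on finite sums of elementary
    tensors are [gram r].  The key step, [kraus_operator_below], produces from
    [r] and a vector [h] an operator [K] whose adjoint maps [a f] to a multiple
    of [r a h].  It is well defined since [f] is cyclic and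
    [<h, r (a^* a) h>] is at most a multiple of [|a f|^2], and the
    Cauchy-Schwarz inequality for [<., .>_r] says precisely that
    [r - K^* _ K] is again completely positive.

    For [r = S] and [h = g] the required bound is the invariance of the states;
    the resulting operator [K0] satisfies [K0 g = f], so it already carries the
    whole state and every further operator of the family kills [g]
    ([state_operator]).  For a residual [r] between [0] and [S], the vectors
    [h = b g] with [b] in the commutant of [B] are admissible, because [b]
    commutes with [S (a^* a)] and so
    [<b g, S (a^* a) b g> <= |b|^2 <g, S (a^* a) g> = |b|^2 |a f|^2]
    ([commuting_form_le]).  As [g] is cyclic for the commutant, a nonzero
    residual has [r 1 (b g) <> 0] for some [b], hence admits a nonzero Kraus
    operator ([residual_operator]).  A family containing [K0] that is maximal
    among those with [sum K^* _ K <= S] on [A], which exists by Zorn's lemma,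
    therefore has residual zero, and its sum is the extension ([ucp_extension]).

    The family may be uncountable, which is why unconditional sums are
    developed.  For given square-summable sequences only countably many terms
    of the family matter, so that the sigma-weak functionals pull back to
    functionals of the same form and the sum is normal ([kraus_map_normal]). *)

(** * Inner products *)

(** The discriminant criterion, with the two cross terms kept apart: testing at
    [1] and ['i] shows that they are conjugate, which is why a positive form is
    Hermitian. *)
Lemma quadratic_psd (C : numClosedFieldType) (p q z z' : C) :
  0 <= p -> 0 <= q ->
  (forall a : C, 0 <= a * a^* * p + a^* * z + a * z' + q) ->
  z' = z^* /\ `|z| ^+ 2 <= p * q.
Proof.
move=> p0 q0 H.
have pR : p^* = p by apply/CrealP/ger0_real.
have qR : q^* = q by apply/CrealP/ger0_real.
have zz : z' = z^*.
  have /CrealP := ger0_real (H 1); rewrite !rmorphD !rmorphM /= !rmorph1 pR qR => h1.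
  have /CrealP := ger0_real (H 'i).
  rewrite !rmorphD !rmorphM /= !conjCi !rmorphN /= !conjCi pR qR => hi.
  have e1 : z^* + z'^* = z + z'.
    by apply/eqP; rewrite -subr_eq0; move/eqP: h1; rewrite -subr_eq0 => /eqP <-;
      apply/eqP; ring.
  have e2 : z^* - z'^* = z' - z.
    apply: (mulfI (neq0Ci C)); apply/eqP; rewrite -subr_eq0; move/eqP: hi.
    by rewrite -subr_eq0 => /eqP <-; apply/eqP; ring.
  apply: (@mulfI _ 2%:R); first by rewrite pnatr_eq0.
  rewrite !mulr_natl !mulr2n -[RHS](_ : (z^* + z'^*) + (z^* - z'^*) = _).
    by rewrite e1 e2; ring.
  by ring.
split=> //; rewrite {z'}zz in H.
have [p00|pN0] := eqVneq p 0.
  rewrite p00 mul0r; have [->|z0] := eqVneq z 0; first by rewrite normr0 expr0n.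
  have n0 : `|z| ^+ 2 != 0 by rewrite expf_neq0 // normr_eq0.
  have tR : ((q + 1) / (2 * `|z| ^+ 2))^* = (q + 1) / (2 * `|z| ^+ 2).
    apply/CrealP/ger0_real; apply: divr_ge0; first exact: addr_ge0.
    by rewrite mulr_ge0 // exprn_ge0.
  (* for p = 0 the form is affine in [a]; this argument gives it the value -1 *)
  have := H (- ((q + 1) / (2 * `|z| ^+ 2) * z)).
  rewrite rmorphN rmorphM /= tR p00; set t := (q + 1) / _.
  rewrite [X in 0 <= X -> _](_ : _ = q - 2 * t * (z * z^*)); last by ring.
  rewrite -normCK /t; move: n0; set n := `|z| ^+ 2 => n0.
  rewrite [X in 0 <= X -> _](_ : _ = -1); last by field.
  by rewrite oppr_ge0 ler10.
have pg0 : 0 < p by rewrite lt_def pN0.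
have := H (- (p^-1 * z)).
have pVR : p^-1^* = p^-1 by apply/CrealP/ger0_real; rewrite invr_ge0.
rewrite rmorphN rmorphM /= pVR.
rewrite [X in 0 <= X -> _](_ : _ = q - p^-1 * (z * z^*)); last by field.
by rewrite -normCK subr_ge0 ler_pdivrMl.
Qed.

Section InnerProduct.
Context {R : realType} {F : hilbertType R}.
Implicit Types (x y z : F) (k : R[i]).

Lemma innerDr x y z : '[x, y + z] = '[x, y] + '[x, z].
Proof. by have := inner_linear x 1 y z; rewrite scale1r mul1r. Qed.

Lemma inner0r x : '[x, 0] = 0.
Proof. by apply: (@addrI _ '[x, 0]); rewrite -innerDr !addr0. Qed.

Lemma innerZr k x y : '[x, k *: y] = k * '[x, y].
Proof. by have := inner_linear x k y 0; rewrite inner0r !addr0. Qed.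

Lemma innerNr x y : '[x, - y] = - '[x, y].
Proof. by rewrite -scaleN1r innerZr mulN1r. Qed.

Lemma innerBr x y z : '[x, y - z] = '[x, y] - '[x, z].
Proof. by rewrite innerDr innerNr. Qed.

Lemma innerDl x y z : '[x + y, z] = '[x, z] + '[y, z].
Proof. by rewrite innerC innerDr rmorphD /= -!innerC. Qed.

Lemma innerZl k x y : '[k *: x, y] = k^* * '[x, y].
Proof. by rewrite innerC innerZr rmorphM /= -innerC. Qed.

Lemma inner0l x : '[0, x] = 0.
Proof. by rewrite innerC inner0r rmorph0. Qed.

Lemma innerNl x y : '[- x, y] = - '[x, y].
Proof. by rewrite innerC innerNr rmorphN /= -innerC. Qed.

Lemma innerBl x y z : '[x - y, z] = '[x, z] - '[y, z].
Proof. by rewrite innerDl innerNl. Qed.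

Lemma inner_sumr I (r : seq I) x (h : I -> F) :
  '[x, \sum_(i <- r) h i] = \sum_(i <- r) '[x, h i].
Proof.
elim: r => [|i r IH]; first by rewrite !big_nil inner0r.
by rewrite !big_cons innerDr IH.
Qed.

Lemma inner_suml I (r : seq I) x (h : I -> F) :
  '[\sum_(i <- r) h i, x] = \sum_(i <- r) '[h i, x].
Proof.
rewrite innerC inner_sumr rmorph_sum /=.
by apply: eq_bigr => i _; rewrite -innerC.
Qed.

Lemma inner_ge0 x : 0 <= '[x, x].
Proof. by rewrite -norm_inner exprn_ge0. Qed.

Lemma inner_eq0 x : '[x, x] = 0 -> x = 0.
Proof. by rewrite -norm_inner => /eqP; rewrite expf_eq0 /= normr_eq0 => /eqP. Qed.

Lemma psd_form (b : F -> F -> R[i]) x y :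
  (forall x k y z, b x (k *: y + z) = k * b x y + b x z) ->
  (forall k x y z, b (k *: x + y) z = k^* * b x z + b y z) ->
  (forall x, 0 <= b x x) ->
  b y x = (b x y)^* /\ `|b x y| ^+ 2 <= b x x * b y y.
Proof.
move=> br bl b0; apply: quadratic_psd => // a.
have := b0 (a *: x + y); rewrite br !bl.
by rewrite [X in 0 <= X -> _](_ : _ = a * a^* * b x x + a^* * b x y + a * b y x + b y y);
  last by ring.
Qed.

Lemma cauchy_schwarz x y : `|'[x, y]| <= `|x| * `|y|.
Proof.
rewrite -ler_sqr ?nnegrE ?mulr_ge0 // exprMn !norm_inner.
have [||//|//] := @psd_form (fun x y => '[x, y]) x y.
- by move=> *; exact: inner_linear.
- by move=> *; rewrite innerDl innerZl.
- exact: inner_ge0.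
Qed.

End InnerProduct.

(** * The Riesz representation theorem *)

Lemma directed_cauchy_limit (K : numFieldType) (V : completeNormedModType K)
    (T : Type) (D : set T) (B : T -> set V) :
  D !=set0 -> (forall i, D i -> B i !=set0) ->
  (forall i j, D i -> D j -> exists2 k, D k & B k `<=` B i `&` B j) ->
  (forall e : K, 0 < e -> exists2 i, D i &
     forall x y, B i x -> B i y -> `|x - y| < e) ->
  exists u : V, forall e : K, 0 < e -> exists2 i, D i &
     forall x, B i x -> `|u - x| < e.
Proof.
move=> D0 B0 dir cau.
have FF : Filter (filter_from D B) by exact: filter_from_filter.
have PF : ProperFilter (filter_from D B) by exact: filter_from_proper.
have /cauchy_cvg cv : cauchy (filter_from D B).
  apply: cauchy_exP => e /cau[i Di Bi]; have [x Bx] := B0 _ Di.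
  by exists x, i => // y By; rewrite -ball_normE /=; exact: Bi.
exists (lim (filter_from D B)) => e e0.
have := cv (ball (lim (filter_from D B)) e) (nbhsx_ballx _ _ e0).
by move=> [i Di sub]; exists i => // x /sub; rewrite -ball_normE.
Qed.

Section ComplexReals.
Context {R : realType}.
Local Notation C := R[i].

Lemma ler_eps_mul (x k : C) : 0 <= k ->
  (forall e : C, 0 < e -> x <= e * k) -> x <= 0.
Proof.
move=> k0 H; apply/ler_addgt0Pr => e e0; rewrite add0r.
have k1 : 0 < k + 1 by rewrite ltr_wpDl.
rewrite (le_trans (H (e / (k + 1)) (divr_gt0 e0 k1))) //.
by rewrite -mulrA ler_piMr ?(ltW e0) // ler_pdivrMl // mulr1 lerDl.
Qed.

Lemma common_lower_bound (d1 d2 : C) : 0 < d1 -> 0 < d2 ->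
  exists d, [/\ 0 < d, d <= d1 & d <= d2].
Proof.
move=> h1 h2; exists (d1 * d2 / (d1 + d2)).
have h : 0 < d1 + d2 by rewrite addr_gt0.
split; first by rewrite divr_gt0 ?mulr_gt0.
- by rewrite ler_pdivrMr // ler_pM2l // lerDr ltW.
- by rewrite ler_pdivrMr // mulrC ler_pM2l // lerDl ltW.
Qed.

End ComplexReals.

Section Riesz.
Context {R : realType} {F : hilbertType R} {V : lmodType R[i]}.
Local Notation C := R[i].
Variables (E : set V) (j : V -> F) (l : V -> C) (M : C).
Hypothesis E0 : E 0.
Hypothesis EL : forall k a b, E a -> E b -> E (k *: a + b).
Hypothesis jL : forall k a b, E a -> E b -> j (k *: a + b) = k *: j a + j b.
Hypothesis lL : forall k a b, E a -> E b -> l (k *: a + b) = k * l a + l b.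
Hypothesis M0 : 0 <= M.
Hypothesis lM : forall a, E a -> `|l a| <= M * `|j a|.

Let Phi (a : V) : C := '[j a, j a] - l a - (l a)^*.
(* the points of [E] that minimise [Phi] up to [d] *)
Let N (d : C) : set V := [set a | E a /\ forall b, E b -> Phi a <= Phi b + d].

Let conj_inner (x : F) : '[x, x]^* = '[x, x].
Proof. by rewrite -innerC. Qed.

Let Phi_real a : Phi a \is Num.real.
Proof.
by apply/CrealP; rewrite /Phi !rmorphB /= conjCK conj_inner; ring.
Qed.

Let Phi_lb a : E a -> - M ^+ 2 <= Phi a.
Proof.
move=> Ea; have h : l a + (l a)^* <= 2 * (M * `|j a|).
  apply: le_trans (_ : `|l a| + `|(l a)^*| <= _); last first.
    by rewrite norm_conjC mulr_natl mulr2n lerD // lM.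
  rewrite (le_trans _ (ler_normD _ _)) // real_ler_norm //.
  by apply/CrealP; rewrite rmorphD /= conjCK addrC.
rewrite /Phi -norm_inner -subr_ge0.
have -> : `|j a| ^+ 2 - l a - (l a)^* - - M ^+ 2 =
  (`|j a| - M) ^+ 2 + (2 * (M * `|j a|) - (l a + (l a)^*)) by ring.
rewrite addr_ge0 ?subr_ge0 // real_exprn_even_ge0 //.
by rewrite realB ?normr_real ?ger0_real.
Qed.

Let N_nonempty (d : C) : 0 < d -> N d !=set0.
Proof.
move=> d0; pose X := [set complex.Re (Phi a) | a in E].
have hlb : has_lbound X.
  exists (complex.Re (- M ^+ 2)) => _ [a Ea <-].
  by have := Phi_lb Ea; rewrite lecE => /andP[].
have hX : has_inf X by split=> //; exists (complex.Re (Phi 0)), 0.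
have dR : (complex.Re d)%:C%C = d by rewrite RRe_real ?ger0_real ?ltW.
have rd : 0 < complex.Re d by move: d0; rewrite ltcE => /andP[].
have [_ [a Ea <-] la] := inf_adherent rd hX.
exists a; split=> // b Eb.
rewrite -(RRe_real (Phi_real a)) -(RRe_real (Phi_real b)) -dR -rmorphD lecR.
by rewrite (le_trans (ltW la)) // lerD2r; apply: ge_inf => //; exists b.
Qed.

(* the parallelogram law, with the midpoint as competitor *)
Let N_close d a b : N d a -> N d b -> `|j a - j b| ^+ 2 <= 4 * d.
Proof.
move=> [Ea Na] [Eb Nb]; pose c := 2^-1 *: a + (2^-1 *: b + 0).
have Eb2 : E (2^-1 *: b + 0) by exact: EL.
have Ec : E c by exact: EL.
have j0 : j 0 = 0.
  by have := jL (-1) E0 E0; rewrite scaler0 addr0 scaleN1r addNr.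
have l0 : l 0 = 0.
  by have := lL (-1) E0 E0; rewrite scaler0 addr0 mulN1r addNr.
have jc : j c = 2^-1 *: j a + 2^-1 *: j b by rewrite !jL // j0 addr0.
have lc : l c = 2^-1 * l a + 2^-1 * l b by rewrite !lL // l0 addr0.
have h2 : (2^-1 : C)^* = 2^-1.
  by apply/CrealP/ger0_real; rewrite invr_ge0 ler0n.
have := lerD (Na _ Ec) (Nb _ Ec); rewrite -subr_ge0 => h.
rewrite norm_inner -subr_ge0.
have -> : 4 * d - '[j a - j b, j a - j b] =
   2 * (Phi c + d + (Phi c + d) - (Phi a + Phi b)).
  rewrite /Phi jc lc !(innerDl, innerDr, innerNl, innerNr, innerZl, innerZr) h2.
  by rewrite !(rmorphD, rmorphM) /= h2; field.
by rewrite mulr_ge0 // ler0n.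
Qed.

(* comparing [Phi a] with [Phi (t *: h + a)] for all scalars [t] *)
Let N_variation d a h : 0 < d -> N d a -> E h ->
  `|'[j a, j h] - l h| ^+ 2 <= `|j h| ^+ 2 * d.
Proof.
move=> d0 [Ea Na] Eh; rewrite norm_inner -norm_conjC.
have [||t|//] := @quadratic_psd _ '[j h, j h] d ('[j a, j h] - l h)^*
  ('[j a, j h] - l h); [exact: inner_ge0|exact: ltW|].
have := Na _ (EL t Eh Ea); rewrite -subr_ge0.
rewrite [X in 0 <= X -> _](_ : _ = t * t^* * '[j h, j h] +
  t^* * ('[j a, j h] - l h)^* + t * ('[j a, j h] - l h) + d) //.
rewrite /Phi jL // lL // !(innerDl, innerDr, innerZl, innerZr) /=.
by rewrite (innerC (j a) (j h)) !(rmorphD, rmorphM, rmorphB) /=; ring.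
Qed.

(** Near-minimisers of the real functional [|j a|^2 - 2 Re (l a)] have
    converging images by the parallelogram law, and the vanishing of its
    variation at the limit is the representation formula.  The bound forces [l]
    to factor through [j], and [u] is found in the closure of the image, so the
    extension of a functional from a dense subspace is included. *)
Lemma riesz_along : exists u : F, forall a, E a -> '[u, j a] = l a.
Proof.
have [|||e e0|u Hu] := @directed_cauchy_limit _ F C [set d | 0 < d]
    (fun d => [set j a | a in N d]).
- by exists 1; exact: ltr01.
- by move=> d /N_nonempty[a Na]; exists (j a), a.
- move=> d1 d2 h1 h2; have [d [d0 d1d d2d]] := common_lower_bound h1 h2.
  exists d => // _ [a [Ea Na] <-].
  by split; exists a => //; split=> // b Eb; rewrite (le_trans (Na _ Eb))// lerD2l.
- have e8 : 0 < e ^+ 2 / 8 by rewrite divr_gt0 ?exprn_gt0 ?ltr0n.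
  exists (e ^+ 2 / 8) => // _ _ [a Na <-] [b Nb <-].
  rewrite -ltr_sqr ?nnegrE ?normr_ge0 ?ltW // (le_lt_trans (N_close Na Nb)) //.
  rewrite [X in X < _](_ : _ = e ^+ 2 / 2); last by field.
  by rewrite ltr_pdivrMr ?ltr0n // mulr_natr mulr2n ltrDl exprn_gt0.
exists u => h Eh; apply/eqP; rewrite -subr_eq0 -normr_le0.
apply: (@ler_eps_mul _ _ (`|j h| *+ 2)); first by rewrite mulrn_wge0.
move=> e e0; have [d d0 Hd] := Hu _ e0.
have e2 : 0 < e ^+ 2 by rewrite exprn_gt0.
have [d' [d'0 d'd d'e]] := common_lower_bound d0 e2.
have [a [Ea Na]] := N_nonempty d'0.
have Nda : N d a by split=> // b Eb; rewrite (le_trans (Na _ Eb)) // lerD2l.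
have -> : '[u, j h] - l h = '[u - j a, j h] + ('[j a, j h] - l h).
  by rewrite innerBl; ring.
rewrite mulrnAr mulr2n (le_trans (ler_normD _ _)) // lerD //.
  rewrite (le_trans (cauchy_schwarz _ _)) // ler_wpM2r //.
  by apply/ltW/Hd; exists a.
rewrite -ler_sqr ?nnegrE ?normr_ge0 ?mulr_ge0 ?(ltW e0) ?normr_ge0 //.
rewrite (le_trans (N_variation d'0 (conj Ea Na) Eh)) // exprMn mulrC.
by rewrite ler_wpM2r // exprn_ge0.
Qed.

End Riesz.

(** * Bounded operators, adjoints and dense sets *)

Section Operators.
Context {R : realType} {F : hilbertType R}.
Local Notation C := R[i].
Implicit Types (S T : 'B(F)) (x y : F) (k : C).

Lemma bop_linear T k x y : T (k *: x + y) = k *: T x + T y.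
Proof. by have /asboolP[+ _] := bop_funP T; exact. Qed.

Lemma bop0 T : T 0 = 0.
Proof. by have := bop_linear T (-1) 0 0; rewrite scaler0 addr0 scaleN1r addNr. Qed.

Lemma bopZ T k x : T (k *: x) = k *: T x.
Proof. by have := bop_linear T k x 0; rewrite bop0 !addr0. Qed.

Lemma bop_bounded T : exists2 M : C, 0 < M & forall x, `|T x| <= M * `|x|.
Proof.
have /asboolP[_ [M HM]] := bop_funP T.
have [T0|] := pselect (forall x, T x = 0).
  by exists 1 => // x; rewrite T0 normr0 mulr_ge0.
move=> /existsNP[x0 /eqP Tx0].
have x0N0 : x0 != 0 by apply: contra_neq Tx0 => ->; rewrite bop0.
have M0 : 0 < M.
  rewrite -(@pmulr_lgt0 _ `|x0|) ?normr_gt0 //.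
  by rewrite (lt_le_trans _ (HM x0)) // normr_gt0.
by exists M.
Qed.

Lemma bop_ext S T : (forall x, S x = T x) -> S = T.
Proof. by move=> H; apply: val_inj; apply/funext. Qed.

Lemma bop_inner_ext S T : (forall x y, '[x, S y] = '[x, T y]) -> S = T.
Proof.
move=> H; apply: bop_ext => y; apply/eqP; rewrite -subr_eq0; apply/eqP.
by apply: inner_eq0; rewrite innerBr H subrr.
Qed.

Lemma scale_bopE k S T x : (k *: S + T) x = k *: S x + T x.
Proof. by []. Qed.

(** For fixed [y] the functional [x |-> (b x y)^*] is linear and bounded; the
    vector that represents it is [T y]. *)
Lemma bop_of_form (b : F -> F -> C) (M : C) : 0 <= M ->
  (forall x k y z, b x (k *: y + z) = k * b x y + b x z) ->
  (forall k x y z, b (k *: x + y) z = k^* * b x z + b y z) ->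
  (forall x y, `|b x y| <= M * `|x| * `|y|) ->
  exists T : 'B(F), forall x y, '[x, T y] = b x y.
Proof.
move=> M0 br bl bM.
have /choice[t Ht] y : exists u, forall x, '[x, u] = b x y.
  have [||||||u Hu] := @riesz_along _ F F setT id (fun x => (b x y)^*) (M * `|y|) => //.
  - by move=> k a c _ _; rewrite bl rmorphD rmorphM /= conjCK.
  - by rewrite mulr_ge0.
  - by move=> x _; rewrite norm_conjC mulrAC; exact: bM.
  by exists u => x; rewrite innerC Hu // conjCK.
have tP : t \in bounded_operator_pred.
  apply/asboolP; split=> [k x y|].
    apply/eqP; rewrite -subr_eq0; apply/eqP/inner_eq0.
    set v := (X in '[X, _]); rewrite innerBr innerDr innerZr !Ht br; exact: subrr.
  exists M => y; have := bM (t y) y; rewrite -Ht -norm_inner ger0_norm ?exprn_ge0 //.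
  have [->|N0] := eqVneq (t y) 0; first by rewrite normr0 mulr_ge0.
  by rewrite mulrAC expr2 ler_pM2r // normr_gt0.
by exists (Bop tP).
Qed.

Lemma adjoint_exists T : exists U : 'B(F), is_adjoint T U.
Proof.
have [M M0 TM] := bop_bounded T.
have [|||U HU] := @bop_of_form (fun x y => '[T x, y]) M (ltW M0).
- by move=> *; exact: inner_linear.
- by move=> *; rewrite bop_linear innerDl innerZl.
- by move=> x y; rewrite (le_trans (cauchy_schwarz _ _)) // ler_wpM2r.
by exists U => x y; rewrite innerC HU -innerC.
Qed.

(** Adjoints are unique ([adj_unique]), so this choice is the adjoint. *)
Definition adj T : 'B(F) := sval (cid (adjoint_exists T)).

Lemma adjE T x y : '[adj T x, y] = '[x, T y].
Proof. exact: (svalP (cid (adjoint_exists T))). Qed.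

Lemma adjEr T x y : '[x, adj T y] = '[T x, y].
Proof. by rewrite innerC adjE -innerC. Qed.

Lemma adj_unique T U : is_adjoint T U -> U = adj T.
Proof. by move=> H; apply: bop_inner_ext => x y; rewrite adjEr innerC H -innerC. Qed.

Lemma adj_one : adj bop_one = bop_one :> 'B(F).
Proof. by apply/esym/adj_unique. Qed.

End Operators.

Section Density.
Context {R : realType} {F : hilbertType R}.
Local Notation C := R[i].
Variable D : set F.
Hypothesis denseD : closure D = [set: F].

Lemma dense_approx (x : F) (e : C) : 0 < e -> exists2 d, D d & `|x - d| < e.
Proof.
move=> e0; have : closure D x by rewrite denseD.
by move=> /(_ _ (nbhsx_ballx x e e0))[d [Dd]]; rewrite -ball_normE => xd; exists d.
Qed.

Lemma dense_norm_le (v : F) (c : C) : 0 <= c ->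
  (forall d, D d -> `|'[v, d]| <= c * `|d|) -> `|v| <= c.
Proof.
move=> c0 H; have [->|v0] := eqVneq v 0; first by rewrite normr0.
have vg : 0 < `|v| by rewrite normr_gt0.
rewrite -(ler_pM2r vg) -expr2 -subr_le0.
apply: (@ler_eps_mul _ _ (c + `|v|)); first by rewrite addr_ge0.
move=> e e0; have [d Dd vd] := dense_approx v e0.
have h1 : `|v| ^+ 2 <= `|'[v, d]| + `|'[v, v - d]|.
  rewrite -[X in X <= _]ger0_norm ?exprn_ge0 // norm_inner.
  by rewrite (_ : '[v, v] = '[v, d] + '[v, v - d]) ?ler_normD // -innerDr subrKC.
have h2 : `|'[v, v - d]| <= `|v| * e.
  by rewrite (le_trans (cauchy_schwarz _ _)) // ler_wpM2l // ltW.
have h3 : `|d| <= `|v| + e.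
  by rewrite -[d](subKr v) (le_trans (ler_normB _ _)) // lerD2l ltW.
have h4 : `|'[v, d]| <= c * (`|v| + e) by rewrite (le_trans (H _ Dd)) // ler_wpM2l.
rewrite lerBlDr (le_trans h1) // (le_trans (lerD h4 h2)) //.
by rewrite le_eqVlt; apply/orP; left; apply/eqP; ring.
Qed.

Lemma dense_inner_eq (u v : F) : (forall d, D d -> '[u, d] = '[v, d]) -> u = v.
Proof.
move=> H; apply/eqP; rewrite -subr_eq0 -normr_le0; apply: dense_norm_le => // d Dd.
by rewrite innerBl H // subrr normr0 mul0r.
Qed.

End Density.

(** * Operators commuting with a positive operator *)

Lemma natmul_bounded_le0 (R : realType) (d k : R[i]) : 0 <= d ->
  (forall n, n%:R * d <= k) -> d <= 0.
Proof.
move=> d0 H.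
have dE : (complex.Re d)%:C%C = d by rewrite RRe_real ?ger0_real.
have kE : (complex.Re k)%:C%C = k.
  by rewrite RRe_real ?ger0_real // (le_trans _ (H 0%N)) // mul0r.
rewrite -dE -(rmorph0 (real_complex R)) lecR leNgt; apply/negP => dp.
have q0 : 0 <= `|complex.Re k| / complex.Re d by rewrite divr_ge0 // ltW.
have := archi_boundP q0; set n := Num.bound _.
rewrite ltr_pdivrMr // => h.
have := H n; rewrite -dE -kE -(rmorph_nat (real_complex R)) -rmorphM lecR leNgt.
by rewrite (le_lt_trans (ler_norm _) h).
Qed.

Lemma bernoulli_le (R : numDomainType) (d : R) n :
  0 <= d -> 1 + n%:R * d <= (1 + d) ^+ n.
Proof.
move=> d0; elim: n => [|n IH]; first by rewrite mul0r addr0 expr0.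
rewrite exprS (le_trans _ (ler_wpM2l _ IH)) ?addr_ge0 //.
rewrite -subr_ge0 [X in 0 <= X](_ : _ = n%:R * d ^+ 2); last by rewrite -natr1; ring.
by rewrite mulr_ge0 ?exprn_ge0.
Qed.

(** If [s] is positive, then [s * (t 0 / s) ^+ (2 ^ n) <= t n] by induction, and
    the left-hand side outgrows [K * m ^+ (2 ^ n)] as soon as [t 0 / s] exceeds
    [m]; if [s = 0], then already [t 0 ^+ 2 <= 0]. *)
Lemma squaring_bound (R : realType) (t : nat -> R[i]) (s m K : R[i]) :
  0 <= s -> 0 <= m -> (forall n, 0 <= t n) ->
  (forall n, t n ^+ 2 <= s * t n.+1) ->
  (forall n, t n <= K * m ^+ (2 ^ n)) -> t 0%N <= m * s.
Proof.
move=> s0 m0 t0 tS tK.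
have [sE|sN] := eqVneq s 0.
  have := tS 0%N; rewrite sE mul0r => h; rewrite mulr0.
  have : t 0%N ^+ 2 == 0 by rewrite eq_le h exprn_ge0.
  by rewrite expf_eq0 /= => /eqP ->.
have sp : 0 < s by rewrite lt_def sN.
rewrite real_leNgt ?ger0_real ?mulr_ge0 //; apply/negP => lt.
pose r := t 0%N / s.
have mr : m < r by rewrite ltr_pdivlMr.
have r0 : 0 <= r by rewrite (le_trans m0) // ltW.
have tr n : s * r ^+ (2 ^ n) <= t n.
  elim: n => [|n IH]; first by rewrite expn0 expr1 mulrC divfK.
  rewrite -(ler_pM2l sp) (le_trans _ (tS n)) // expnSr exprM mulrA -expr2 -exprMn.
  by rewrite ler_sqr ?nnegrE // mulr_ge0 // exprn_ge0.
have [mE|mN] := eqVneq m 0.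
  have := le_trans (tr 0%N) (tK 0%N).
  rewrite mE expn0 !expr1 mulr0 pmulr_rle0 // => rle.
  by move: mr; rewrite mE => /lt_le_trans/(_ rle); rewrite ltxx.
have mp : 0 < m by rewrite lt_def mN.
pose d := r / m - 1.
have dp : 0 < d by rewrite subr_gt0 ltr_pdivlMr // mul1r.
have : d <= 0.
  apply: (@natmul_bounded_le0 _ _ (K / s)); first exact: ltW.
  move=> n; rewrite ler_pdivlMr //.
  have := le_trans (tr n) (tK n).
  rewrite -ler_pdivrMr ?exprn_gt0 // -mulrA -expr_div_n => h.
  rewrite (le_trans _ h) // mulrC ler_pM2l //.
  have -> : r / m = 1 + d by rewrite addrC subrK.
  rewrite (@le_trans _ _ ((1 + d) ^+ n)) //.
    by rewrite (le_trans _ (bernoulli_le n (ltW dp))) // lerDr.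
  by rewrite ler_weXn2l ?lerDl ?(ltW dp) // ltnW // ltn_expl.
by move=> /(lt_le_trans dp); rewrite ltxx.
Qed.

Section CommutingForm.
Context {R : realType} {G : hilbertType R}.
Local Notation C := R[i].
Variables (P b : 'B(G)) (M : C).
Hypothesis M0 : 0 <= M.
Hypothesis bM : forall x, `|b x| <= M * `|x|.
Hypothesis P0 : forall x, 0 <= '[x, P x].
Hypothesis bP : forall x, b (P x) = P (b x).

Let psdP x y : '[y, P x] = '[x, P y]^* /\ `|'[x, P y]| ^+ 2 <= '[x, P x] * '[y, P y].
Proof.
apply: (@psd_form _ _ (fun x y => '[x, P y])) => //.
- by move=> *; rewrite bop_linear innerDr innerZr.
- by move=> *; rewrite innerDl innerZl.
Qed.

Let P_selfadjoint x y : '[P x, y] = '[x, P y].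
Proof. by rewrite innerC; have [-> _] := psdP x y; rewrite conjCK. Qed.

Let D (x : G) : G := adj b (b x).

Let D_sym n x y : '[iter n D x, P y] = '[x, P (iter n D y)].
Proof.
elim: n x y => // n IH x y; rewrite iterSr iterS IH adjE.
by rewrite bP -P_selfadjoint -bP -adjEr P_selfadjoint.
Qed.

Let D_norm n x : `|iter n D x| <= (M ^+ 2) ^+ n * `|x|.
Proof.
have adjM y : `|adj b y| <= M * `|y|.
  have [->|N0] := eqVneq (adj b y) 0; first by rewrite normr0 mulr_ge0.
  have e : `|adj b y| ^+ 2 = `|'[y, b (adj b y)]|.
    by rewrite -adjE -norm_inner normrX normr_id.
  have h : `|adj b y| ^+ 2 <= `|y| * (M * `|adj b y|).
    by rewrite e (le_trans (cauchy_schwarz _ _)) // ler_wpM2l.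
  by move: h; rewrite mulrA expr2 ler_pM2r ?normr_gt0 // mulrC.
elim: n => [|n IH]; first by rewrite expr0 mul1r.
rewrite iterS (le_trans (adjM _)) // exprS expr2 -!mulrA ler_wpM2l //.
by rewrite (le_trans (bM _)) // ler_wpM2l.
Qed.

(** With the square root of [P], which also commutes with [b], this would be
    immediate.  To avoid square roots, iterate the Cauchy-Schwarz inequality of
    the form of [P], for which the powers of [D], the product of [b] with its
    adjoint, are symmetric: [t n], the value of the form at [x] and [D ^ (2 ^ n) x],
    satisfies [t n ^+ 2 <= t' * t n.+1] with [t'] its value at [x] and [x]. *)
Lemma commuting_form_le x : '[b x, P (b x)] <= M ^+ 2 * '[x, P x].
Proof.
have [p p0 pP] := bop_bounded P.
pose t n := '[x, P (iter (2 ^ n) D x)].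
have tS n : t n.+1 = '[iter (2 ^ n) D x, P (iter (2 ^ n) D x)].
  by rewrite D_sym -iterD addnn -mul2n -expnS.
have bx : '[b x, P (b x)] = t 0%N.
  by rewrite /t expn0 /= -(P_selfadjoint x) adjEr bP P_selfadjoint.
rewrite bx; apply: (@squaring_bound _ t _ _ (p * `|x| ^+ 2)) => //.
- by rewrite exprn_ge0.
- by case=> [|n]; rewrite -?bx ?tS.
- move=> n; rewrite tS; have [_] := psdP x (iter (2 ^ n) D x).
  by rewrite -/(t n) ger0_norm //; case: n => [|n]; rewrite -?bx ?tS.
- move=> n; apply: le_trans (_ : `|t n| <= _).
    by rewrite real_ler_norm // ger0_real //; case: n => [|n]; rewrite -?bx ?tS.
  rewrite (le_trans (cauchy_schwarz _ _)) //.
  rewrite [leRHS](_ : _ = `|x| * (p * ((M ^+ 2) ^+ (2 ^ n) * `|x|))); last by ring.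
  by rewrite ler_wpM2l // (le_trans (pP _)) // ler_pM2l // D_norm.
Qed.

End CommutingForm.

(** * Unconditional sums *)

Section UnconditionalSums.
Context {R : realType}.
Local Notation C := R[i].
Implicit Types (I J : choiceType).

Lemma big_uniq_sub I (V : zmodType) (h : I -> V) (s0 s : seq I) :
  uniq s0 -> uniq s -> {subset s0 <= s} ->
  \sum_(i <- s) h i = \sum_(i <- s0) h i + \sum_(i <- s | i \notin s0) h i.
Proof.
move=> u0 u sub; rewrite (bigID (mem s0)) /=; congr (_ + _).
rewrite -big_filter; apply: perm_big; apply: uniq_perm => //; first exact: filter_uniq.
by move=> i; rewrite mem_filter; case: (boolP (i \in s0)) => // /sub ->.
Qed.

(** The finite subsets of the index type are represented by duplicate-free
    sequences. *)
Definition usums I (h : I -> C) (L : C) : Prop :=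
  forall e : C, 0 < e -> exists s0 : seq I, forall s, uniq s ->
    {subset s0 <= s} -> `|\sum_(i <- s) h i - L| < e.

Lemma usums_unique I (h : I -> C) L1 L2 : usums h L1 -> usums h L2 -> L1 = L2.
Proof.
move=> H1 H2; apply/eqP; rewrite -subr_eq0 -normr_le0.
apply: (@ler_eps_mul _ _ 2) => // e e0.
have [s1 h1] := H1 _ e0; have [s2 h2] := H2 _ e0.
pose s := undup (s1 ++ s2).
have us : uniq s by exact: undup_uniq.
have e1 : `|\sum_(i <- s) h i - L1| < e.
  by apply: h1 => // i i1; rewrite mem_undup mem_cat i1.
have e2 : `|\sum_(i <- s) h i - L2| < e.
  by apply: h2 => // i i1; rewrite mem_undup mem_cat i1 orbT.
rewrite mulr_natr mulr2n [X in `|X|](_ : _ =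
  (\sum_(i <- s) h i - L2) - (\sum_(i <- s) h i - L1)); last by ring.
by rewrite (le_trans (ler_normB _ _)) // lerD // ltW.
Qed.

Lemma usums_lin I (k : C) (h1 h2 : I -> C) L1 L2 : usums h1 L1 -> usums h2 L2 ->
  usums (fun i => k * h1 i + h2 i) (k * L1 + L2).
Proof.
move=> H1 H2 e e0.
have k0 : 0 < `|k| + 1 by rewrite ltr_wpDl.
have e1 : 0 < e / 2 / (`|k| + 1) by rewrite !divr_gt0 // ltr0n.
have e2 : 0 < e / 2 by rewrite divr_gt0 // ltr0n.
have [s1 h1P] := H1 _ e1; have [s2 h2P] := H2 _ e2.
exists (s1 ++ s2) => s us sub.
have {}h1P : `|\sum_(i <- s) h1 i - L1| < e / 2 / (`|k| + 1).
  by apply: h1P => // i i1; apply: sub; rewrite mem_cat i1.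
have {}h2P : `|\sum_(i <- s) h2 i - L2| < e / 2.
  by apply: h2P => // i i2; apply: sub; rewrite mem_cat i2 orbT.
rewrite big_split /= -mulr_sumr [X in `|X|](_ : _ =
  k * (\sum_(i <- s) h1 i - L1) + (\sum_(i <- s) h2 i - L2)); last by ring.
rewrite (le_lt_trans (ler_normD _ _)) // normrM (splitr e).
apply: ler_ltD => //.
rewrite (@le_trans _ _ (`|k| * (e / 2 / (`|k| + 1)))) //.
  by rewrite ler_wpM2l // ltW.
by rewrite mulrCA ler_piMr ?(ltW e2) // ler_pdivrMr // mul1r lerDl.
Qed.

Lemma usums_ext I (h1 h2 : I -> C) L :
  (forall i, h1 i = h2 i) -> usums h1 L -> usums h2 L.
Proof. by move=> /funext ->. Qed.

Lemma usums0 I : usums (fun _ : I => 0) 0.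
Proof. by move=> e e0; exists [::] => s _ _; rewrite big1 // subrr normr0. Qed.

Lemma usums_sum I T (r : seq T) (h : T -> I -> C) (L : T -> C) :
  (forall j, usums (h j) (L j)) ->
  usums (fun i => \sum_(j <- r) h j i) (\sum_(j <- r) L j).
Proof.
move=> H; elim: r => [|j r IH].
  by rewrite big_nil; apply: usums_ext (usums0 I) => i; rewrite big_nil.
rewrite big_cons -[L j]mul1r; apply: usums_ext (usums_lin 1 (H j) IH) => i.
by rewrite big_cons mul1r.
Qed.

Lemma usums_conj I (h : I -> C) L : usums h L -> usums (fun i => (h i)^*) L^*.
Proof.
move=> H e /H[s0 h0]; exists s0 => s us sub.
by rewrite -rmorph_sum -rmorphB /= norm_conjC; exact: h0.
Qed.

Lemma usums_norm_le I (h : I -> C) L M : usums h L ->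
  (forall s, uniq s -> `|\sum_(i <- s) h i| <= M) -> `|L| <= M.
Proof.
move=> H HM; apply/ler_addgt0Pr => e /H[s0 h0].
have us := undup_uniq s0.
have : `|\sum_(i <- undup s0) h i - L| < e by apply: h0 => // i; rewrite mem_undup.
rewrite distrC => h1.
rewrite -(subrK (\sum_(i <- undup s0) h i) L) addrC.
by rewrite (le_trans (ler_normD _ _)) // lerD ?HM // ltW.
Qed.

Lemma usums_ge I (h : I -> C) L s : usums h L -> (forall i, 0 <= h i) ->
  uniq s -> \sum_(i <- s) h i <= L.
Proof.
move=> H h0 us.
have LR : L \is Num.real.
  apply/CrealP; apply: (usums_unique (usums_conj H)).
  by apply: usums_ext H => i; apply/esym/CrealP/ger0_real.
have SR t : \sum_(i <- t) h i \is Num.real by apply: ger0_real; exact: sumr_ge0.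
apply/ler_addgt0Pr => e /H[s0 h1]; pose t := undup (s0 ++ s).
have ut : uniq t by exact: undup_uniq.
have {}h1 : `|\sum_(i <- t) h i - L| < e.
  by apply: h1 => // i i0; rewrite mem_undup mem_cat i0.
have : \sum_(i <- s) h i <= \sum_(i <- t) h i.
  rewrite (@big_uniq_sub _ _ h s t) // ?lerDl ?sumr_ge0 //.
  by move=> i i0; rewrite mem_undup mem_cat i0 orbT.
move/le_trans; apply; rewrite -lerBlDl (le_trans _ (ltW h1)) // real_ler_norm //.
exact: realB.
Qed.

Lemma usums_ge0 I (h : I -> C) L : usums h L -> (forall i, 0 <= h i) -> 0 <= L.
Proof. by move=> H h0; have := usums_ge H h0 (isT : uniq [::]); rewrite big_nil. Qed.

Lemma usums_single I (i0 : I) (h : I -> C) :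
  (forall i, i != i0 -> h i = 0) -> usums h (h i0).
Proof.
move=> H e e0; exists [:: i0] => s us sub.
have i0s : i0 \in s by apply: sub; rewrite inE.
by rewrite (bigD1_seq i0) //= big1 ?addr0 ?subrr ?normr0 // => i /andP[? /H].
Qed.

(** The inner sums are approximated along rectangles [s] times [t], where [t]
    is large enough for each of the finitely many rows in [s]. *)
Lemma usums_pair I J (h : I * J -> C) (l : I -> C) L : usums h L ->
  (forall i, usums (fun j => h (i, j)) (l i)) -> usums l L.
Proof.
move=> H Hl e e0.
have e2 : 0 < e / 2 by rewrite divr_gt0 // ltr0n.
have [s0 h0] := H _ e2; exists (map fst s0) => s us sub.
have e3 : 0 < e / 2 / (size s).+1%:R by rewrite divr_gt0 // ltr0n.
have /choice[T HT] i : exists t : seq J, forall t', uniq t' -> {subset t <= t'} ->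
   `|\sum_(j <- t') h (i, j) - l i| < e / 2 / (size s).+1%:R by exact: Hl.
pose t := undup (map snd s0 ++ flatten (map T s)).
have ut : uniq t by exact: undup_uniq.
pose st := [seq (i, j) | i <- s, j <- t].
have ust : uniq st by apply: allpairs_uniq => // -[? ?] [? ?].
have h1 : `|\sum_(p <- st) h p - L| < e / 2.
  apply: h0 => // -[i j] ij; apply/allpairsP; exists (i, j); split => //=.
    by apply: sub; apply/mapP; exists (i, j).
  by rewrite mem_undup mem_cat; apply/orP; left; apply/mapP; exists (i, j).
rewrite [X in `|X|](_ : _ = (\sum_(p <- st) h p - L) -
   \sum_(i <- s) (\sum_(j <- t) h (i, j) - l i)); last first.
  by rewrite /st big_allpairs big_split /= sumrN; ring.
rewrite (le_lt_trans (ler_normB _ _)) // (splitr e) ltr_leD //.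
rewrite (le_trans (ler_norm_sum _ _ _)) //.
rewrite (@le_trans _ _ (\sum_(i <- s) e / 2 / (size s).+1%:R)) //.
  rewrite big_seq [leRHS]big_seq; apply: ler_sum => i is_; apply/ltW/HT => // j ij.
  rewrite mem_undup mem_cat; apply/orP; right; apply/flattenP; exists (T i) => //.
  exact: map_f.
rewrite big_const_seq count_predT iter_addr_0 -[leLHS]mulr_natl
  mulrCA.
by rewrite ler_piMr ?(ltW e2) // ler_pdivrMr ?ltr0n // mul1r ler_nat.
Qed.

Lemma usums_nat_cvg (h : nat -> C) L : usums h L -> series h @ \oo --> L.
Proof.
move=> H; apply/cvgrPdist_lt => e /H[s0 h0].
exists (\max_(k <- s0) k).+1 => // n /= sn; rewrite distrC; apply: h0.
  exact: iota_uniq.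
move=> k ks; rewrite mem_index_iota /=; apply: leq_ltn_trans sn.
by rewrite (big_rem k) //= leq_maxl.
Qed.

Lemma cvg_series_bounded_sums (c : nat -> C) : (forall k, 0 <= c k) ->
  cvgn (series c) -> exists M, forall s, uniq s -> \sum_(k <- s) c k <= M.
Proof.
move=> c0 /cvg_seq_bounded[M [Mr HM]]; exists (M + 1) => s us.
have Mlt : M < M + 1 by rewrite ltrDl.
have := HM _ Mlt (\max_(k <- s) k).+1 I; rewrite /series /= => h.
rewrite (le_trans _ h) // (le_trans _ (real_ler_norm _)) ?ger0_real ?sumr_ge0 //.
rewrite (@big_uniq_sub _ _ c s (index_iota 0 _)) ?iota_uniq // ?lerDl ?sumr_ge0 //.
move=> k ks; rewrite mem_index_iota /= ltnS.
by rewrite (big_rem k) //= leq_maxl.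
Qed.

End UnconditionalSums.

Section SumExistence.
Context {R : realType}.
Local Notation C := R[i].
Implicit Types (I : choiceType).

Lemma sum_sup_adherent I (c : I -> C) (M e : C) : (forall i, 0 <= c i) ->
  (forall s, uniq s -> \sum_(i <- s) c i <= M) -> 0 < e ->
  exists2 s0, uniq s0 & forall s, uniq s -> {subset s0 <= s} ->
    \sum_(i <- s | i \notin s0) c i < e.
Proof.
move=> c0 cM e0.
have cE s : (complex.Re (\sum_(i <- s) c i))%:C%C = \sum_(i <- s) c i.
  by rewrite RRe_real // ger0_real // sumr_ge0.
pose X := [set complex.Re (\sum_(i <- s) c i) | s in [set s | uniq s]].
have supX : has_sup X.
  split; first by exists (complex.Re (\sum_(i <- [::]) c i)), [::].
  exists (complex.Re M) => _ [s us <-].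
  by have := cM s us; rewrite lecE => /andP[].
have eE : (complex.Re e)%:C%C = e by rewrite RRe_real ?ger0_real ?ltW.
have re : 0 < complex.Re e by move: e0; rewrite ltcE => /andP[].
have [_ [s0 us0 <-] h] := sup_adherent re supX.
exists s0 => // s us sub.
have hs : complex.Re (\sum_(i <- s) c i) <= sup X.
  by apply: ub_le_sup; [case: supX|exists s].
have : complex.Re (\sum_(i <- s) c i) < complex.Re (\sum_(i <- s0) c i) + complex.Re e.
  by rewrite (le_lt_trans hs) // -ltrBlDr.
by rewrite -ltcR rmorphD /= !cE eE (big_uniq_sub c us0 us sub) ltrD2l.
Qed.

(** The tails of the family are controlled by [sum_sup_adherent].  The sums are
    formed on the line spanned by a unit vector, so that the completeness of
    the Hilbert space yields that of the scalars. *)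
Lemma usums_exist (G : hilbertType R) (g : G) I (h : I -> C) (M : C) :
  `|g| = 1 -> (forall s, uniq s -> \sum_(i <- s) `|h i| <= M) ->
  exists L, usums h L.
Proof.
move=> g1 hM.
have [||||u Hu] := @directed_cauchy_limit _ G (seq I) setT
   (fun s0 => [set (\sum_(i <- s) h i) *: g | s in
      [set s : seq I | uniq s /\ {subset s0 <= s}]]).
- by exists [::].
- move=> s0 _; exists ((\sum_(i <- undup s0) h i) *: g), (undup s0) => //.
  by split; [exact: undup_uniq|move=> i; rewrite mem_undup].
- move=> s1 s2 _ _; exists (s1 ++ s2) => // _ [s [us sub] <-].
  by split; exists s => //; split=> // i i1; apply: sub; rewrite mem_cat i1 ?orbT.
- move=> e e0; have e2 : 0 < e / 2 by rewrite divr_gt0 ?ltr0n.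
  have [//|s0 us0 H] := sum_sup_adherent _ hM e2.
  have near s : uniq s -> {subset s0 <= s} ->
      `|\sum_(i <- s) h i - \sum_(i <- s0) h i| < e / 2.
    move=> us sub; rewrite (big_uniq_sub h us0 us sub) addrC addKr.
    by rewrite (le_lt_trans (ler_norm_sum _ _ _)) // H.
  exists s0 => // _ _ [s [us subs] <-] [t [ut subt] <-].
  rewrite -scalerBl normrZ g1 mulr1 (splitr e).
  rewrite [X in `|X|](_ : _ = (\sum_(i <- s) h i - \sum_(i <- s0) h i) -
    (\sum_(i <- t) h i - \sum_(i <- s0) h i)); last by ring.
  by rewrite (le_lt_trans (ler_normB _ _)) // ltrD // near.
exists '[g, u] => e /Hu[s0 _ H]; exists s0 => s us sub.
have gg : '[g, g] = 1 by rewrite -norm_inner g1 expr1n.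
rewrite [X in `|X|](_ : _ = '[g, (\sum_(i <- s) h i) *: g - u]); last first.
  by rewrite innerBr innerZr gg mulr1.
rewrite (le_lt_trans (cauchy_schwarz _ _)) // g1 mul1r distrC H //.
by exists s.
Qed.

(** For every [n], the indices with [1 < n * c i] are at most [n * M] in
    number, and these finite sets exhaust the support. *)
Lemma countable_support I (c : I -> C) (M : C) : (forall i, 0 <= c i) ->
  (forall s, uniq s -> \sum_(i <- s) c i <= M) -> countable [set i | c i != 0].
Proof.
move=> c0 cM.
have -> : [set i | c i != 0] = \bigcup_(n in [set: nat]) [set i | 1 < n%:R * c i].
  apply/seteqP; split=> i /=; last first.
    by move=> [n _] /= h; apply: contraTneq h => ->; rewrite mulr0 ltr10.
  move=> ci; apply: contrapT => H; move/negP: ci; apply.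
  rewrite eq_le c0 andbT; apply: (@natmul_bounded_le0 _ _ 1) => // n.
  rewrite real_leNgt ?ger0_real ?mulr_ge0 //; apply/negP => h; apply: H.
  by exists n.
apply: bigcup_countable => // n _; apply: finite_set_countable.
apply: contrapT => inf.
suff : (1 : C) <= 0 by rewrite ler10.
apply: (@natmul_bounded_le0 _ _ (n%:R * M)) => // m.
have [B BA mB] := infinite_set_fset m inf.
rewrite mulr1 (@le_trans _ _ (\sum_(i <- finmap.enum_fset B) n%:R * c i)) //.
  rewrite (@le_trans _ _ (\sum_(i <- finmap.enum_fset B) 1)) //.
    by rewrite big_const_seq count_predT iter_addr_0 ler_nat.
  by rewrite big_seq [leRHS]big_seq; apply: ler_sum => i /BA /= /ltW.
by rewrite -mulr_sumr ler_wpM2l // cM // finmap.fset_uniq.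
Qed.

Lemma countable_coding I (J : set I) : countable J ->
  exists (code : I -> nat) (dec : nat -> option I),
    ocancel dec code /\ forall i, J i -> dec (code i) = Some i.
Proof.
move=> /countable_injP[code inj].
pose dec k := if pselect (exists i, J i /\ code i = k) is left ex
  then Some (sval (cid ex)) else None.
exists code, dec; split=> [k|i Ji]; rewrite /dec.
  by case: pselect => //= ex; case: (svalP (cid ex)).
case: pselect => [ex|]; last by case; exists i.
have [Jj cj] := svalP (cid ex).
by congr Some; apply: inj; rewrite ?inE.
Qed.

(** The terms outside [J] vanish, so a countable support turns a sum over an
    arbitrary index type into a series. *)
Lemma usums_reindex_nat I (J : set I) (h : I -> C) L code dec :
  ocancel dec code -> (forall i, J i -> dec (code i) = Some i) ->
  (forall i, ~ J i -> h i = 0) -> usums h L ->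
  usums (fun k : nat => oapp h 0 (dec k)) L.
Proof.
move=> decK codeK h0 H e /H[s0 Hs0]; exists (map code s0) => t ut sub.
pose s1 := pmap dec t; pose s2 := [seq i <- undup s0 | i \notin s1].
have us1 : uniq s1 by exact: pmap_uniq decK _ ut.
have us : uniq (s1 ++ s2).
  rewrite cat_uniq us1 filter_uniq ?undup_uniq // andbT.
  by apply/hasPn => i; rewrite mem_filter => /andP[].
have := Hs0 _ us; rewrite big_cat /= big_pmap.
rewrite [X in _ + X - _]big_seq [X in _ + X - _]big1 ?addr0; last first.
  move=> i; rewrite mem_filter mem_undup => /andP[i1 i0].
  apply: h0 => Ji; move/negP: i1; apply; rewrite mem_pmap -(codeK _ Ji).
  by apply: map_f; apply: sub; exact: map_f.
apply=> i i0; rewrite mem_cat mem_filter mem_undup i0 andbT.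
by case: (i \in s1).
Qed.

End SumExistence.

(** * The sigma-weak topology *)

Section SigmaWeak.
Context {R : realType} {F G : hilbertType R}.
Local Notation C := R[i].

Lemma sigma_weak_continuous (X : topologicalType) (h : X -> sigma_weak_bop G) :
  (forall xy, continuous ((fun t => sigma_weak_eval (h t) xy) : X -> C)) ->
  continuous h.
Proof.
move=> H; apply: continuous_comp_initial => t; apply/cvg_sup => xy.
move=> U [? /= [[W oW <-]]] /= Wt /filterS; apply; apply: H.
exact: open_nbhs_nbhs.
Qed.

Lemma sigma_weak_eval_continuous (uv : l2_seq F * l2_seq F) :
  continuous ((fun T => sigma_weak_eval T uv) : sigma_weak_bop F -> C).
Proof.
move=> T; apply: (@cvg_comp _ _ _ (@sigma_weak_eval R F) (fun t => t uv)).
  exact: initial_continuous.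
(* a neighbourhood in the product topology is one for each projection *)
set f := sigma_weak_eval T.
have /cvg_sup/(_ uv) cf : nbhs f --> f by exact: cvg_id.
move=> U /(@initial_continuous _ C (fun t => t uv)) /cf.
exact.
Qed.

(** Since the sigma-weak topology is initial for the functionals
    [sigma_weak_eval _ xy], it suffices that these pull back to functionals of
    the same kind. *)
Lemma normal_of_eval (Z : 'B(F) -> 'B(G)) :
  (forall xy, exists uv, forall T, sigma_weak_eval (Z T) xy = sigma_weak_eval T uv) ->
  normal_on [set: 'B(F)] Z.
Proof.
move=> H; apply: continuous_subspaceT; apply: sigma_weak_continuous => xy.
have [uv E] := H xy.
by under eq_fun do rewrite E; exact: sigma_weak_eval_continuous.
Qed.

End SigmaWeak.

(** * Maps in Kraus form *)

Section KrausMap.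
Context {R : realType} {F G : hilbertType R} {I : choiceType}.
Local Notation C := R[i].
Variables (g : G) (K : I -> G -> F).
Hypothesis g1 : `|g| = 1.
Hypothesis K_linear : forall i, linear (K i).
Hypothesis K_contr : forall y s, uniq s -> \sum_(i <- s) `|K i y| ^+ 2 <= `|y| ^+ 2.

Lemma kraus_term_le (T : 'B(F)) M x y : 0 <= M -> (forall z, `|T z| <= M * `|z|) ->
  forall i, `|'[K i x, T (K i y)]| <= M * (`|K i x| ^+ 2 + `|K i y| ^+ 2).
Proof.
move=> M0 TM i; rewrite (le_trans (cauchy_schwarz _ _)) //.
rewrite (@le_trans _ _ (`|K i x| * (M * `|K i y|))) ?ler_wpM2l // mulrCA ler_wpM2l //.
set a := `|_|; set b := `|_|.
have ab : 0 <= (a - b) ^+ 2.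
  by rewrite real_exprn_even_ge0 // realB // ger0_real // normr_ge0.
have ab2 : 0 <= a * b by rewrite mulr_ge0 ?normr_ge0.
rewrite -subr_ge0 (_ : _ - _ = (a - b) ^+ 2 + a * b); last by ring.
exact: addr_ge0.
Qed.

Lemma kraus_form_exists (T : 'B(F)) x y :
  exists L, usums (fun i => '[K i x, T (K i y)]) L.
Proof.
have [M M0 TM] := bop_bounded T.
apply: (@usums_exist _ _ g _ _ (M * (`|x| ^+ 2 + `|y| ^+ 2))) => // s us.
rewrite (le_trans (ler_sum _ (fun i _ => kraus_term_le x y (ltW M0) TM i))) //.
by rewrite -mulr_sumr ler_pM2l // big_split lerD // K_contr.
Qed.

Let form T x y : C := sval (cid (kraus_form_exists T x y)).

Let formP (T : 'B(F)) x y : usums (fun i => '[K i x, T (K i y)]) (form T x y).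
Proof. exact: (svalP (cid (kraus_form_exists T x y))). Qed.

Let form_linear_r (T : 'B(F)) x k y z :
  form T x (k *: y + z) = k * form T x y + form T x z.
Proof.
apply: (usums_unique (formP T x (k *: y + z))).
apply: usums_ext (usums_lin k (formP T x y) (formP T x z)) => i.
by rewrite K_linear bop_linear innerDr innerZr.
Qed.

Let form_linear_l (T : 'B(F)) k x y z :
  form T (k *: x + y) z = k^* * form T x z + form T y z.
Proof.
apply: (usums_unique (formP T (k *: x + y) z)).
apply: usums_ext (usums_lin k^* (formP T x z) (formP T y z)) => i.
by rewrite K_linear innerDl innerZl.
Qed.

Let form_bounded (T : 'B(F)) : exists2 M, 0 <= M &
  forall x y, `|form T x y| <= M * `|x| * `|y|.
Proof.
have [M M0 TM] := bop_bounded T; exists (2 * M); first by rewrite mulr_ge0 ?ltW.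
have H x y : `|form T x y| <= M * (`|x| ^+ 2 + `|y| ^+ 2).
  apply: (usums_norm_le (formP T x y)) => s us.
  rewrite (le_trans (ler_norm_sum _ _ _)) //.
  rewrite (le_trans (ler_sum _ (fun i _ => kraus_term_le x y (ltW M0) TM i))) //.
  by rewrite -mulr_sumr ler_pM2l // big_split lerD // K_contr.
have fr0 x : form T x 0 = 0.
  by have := form_linear_r T x (-1) 0 0; rewrite scaler0 addr0 mulN1r addNr.
have fl0 y : form T 0 y = 0.
  by have := form_linear_l T (-1) 0 0 y; rewrite scaler0 addr0 rmorphN1 mulN1r addNr.
move=> x y.
have [->|x0] := eqVneq x 0; first by rewrite fl0 !normr0 mulr0 mul0r.
have [->|y0] := eqVneq y 0; first by rewrite fr0 !normr0 mulr0.
have nx : 0 < `|x| by rewrite normr_gt0.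
have ny : 0 < `|y| by rewrite normr_gt0.
(* normalise both arguments, so that the sum of squares becomes a constant *)
have := H (`|x|^-1 *: x + 0) (`|y|^-1 *: y + 0).
rewrite form_linear_l form_linear_r fr0 fl0 !addr0 !normrM !normrZ norm_conjC.
rewrite !normfV !normr_id !mulVf ?gt_eqF // expr1n -mulr2n mulr_natr -mulr_natl.
by rewrite -ler_pdivlMl ?invr_gt0 // invrK -ler_pdivlMl ?invr_gt0 // invrK
  [X in _ <= X -> _](_ : _ = 2 * M * `|x| * `|y|) //; ring.
Qed.

(** The sum of the maps taking [T] to [T] compressed by [K i], defined through
    its matrix coefficients so that only scalar sums occur. *)
Lemma kraus_map_exists : exists Z : 'B(F) -> 'B(G), forall (T : 'B(F)) x y,
  usums (fun i => '[K i x, T (K i y)]) '[x, Z T y].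
Proof.
have /choice[Z HZ] T : exists U : 'B(G), forall x y, '[x, U y] = form T x y.
  by have [M M0 HM] := form_bounded T; exact: bop_of_form HM.
by exists Z => T x y; rewrite HZ.
Qed.

Variable Z : 'B(F) -> 'B(G).
Hypothesis HZ : forall (T : 'B(F)) x y, usums (fun i => '[K i x, T (K i y)]) '[x, Z T y].

Lemma kraus_map_linear k (S T : 'B(F)) : Z (k *: S + T) = k *: Z S + Z T.
Proof.
apply: bop_inner_ext => x y; rewrite scale_bopE innerDr innerZr.
apply: (usums_unique (HZ (k *: S + T) x y)).
apply: usums_ext (usums_lin k (HZ S x y) (HZ T x y)) => i.
by rewrite scale_bopE innerDr innerZr.
Qed.

Lemma kraus_map_cp : completely_positive_on setT Z.
Proof.
move=> n a _ a0 x.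
have H : usums (fun k => \sum_i \sum_j '[K k (x i), a i j (K k (x j))])
    (\sum_i \sum_j '[x i, map_mx Z a i j (x j)]).
  apply: usums_sum => i; apply: usums_sum => j; rewrite mxE; exact: HZ.
by apply: (usums_ge0 H) => k; exact: a0.
Qed.

Lemma square_summable_bounded (x : l2_seq G) :
  exists M, forall s, uniq s -> \sum_(n <- s) `|sval x n| ^+ 2 <= M.
Proof.
by apply: cvg_series_bounded_sums (svalP x) => n; rewrite exprn_ge0.
Qed.

(** A sigma-weak functional of [Z T] is a sum over pairs of a sequence index
    and a Kraus index; enumerating the pairs that contribute makes it a
    sigma-weak functional of [T]. *)
Lemma kraus_map_normal : normal_on setT Z.
Proof.
apply: normal_of_eval => -[x y] /=.
have [Mx HMx] := square_summable_bounded x.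
have [My HMy] := square_summable_bounded y.
pose c (p : nat * I) := `|K p.2 (sval x p.1)| ^+ 2 + `|K p.2 (sval y p.1)| ^+ 2.
have c0 p : 0 <= c p by rewrite addr_ge0 // exprn_ge0.
have cM s : uniq s -> \sum_(p <- s) c p <= Mx + My.
  move=> us; pose sn := undup (map fst s); pose si := undup (map snd s).
  have un : uniq sn by exact: undup_uniq.
  have ui : uniq si by exact: undup_uniq.
  have usi : uniq [seq (n, i) | n <- sn, i <- si].
    by apply: allpairs_uniq => // -[? ?] [? ?].
  apply: le_trans (_ : \sum_(p <- [seq (n, i) | n <- sn, i <- si]) c p <= _).
    rewrite (big_uniq_sub c us usi) ?lerDl ?sumr_ge0 // => -[n i] ni.
    apply/allpairsP; exists (n, i); split=> //; rewrite mem_undup; apply/mapP;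
      by exists (n, i).
  rewrite big_allpairs.
  apply: le_trans (_ : \sum_(n <- sn) (`|sval x n| ^+ 2 + `|sval y n| ^+ 2) <= _).
    by apply: ler_sum => n _; rewrite /c big_split /= lerD // K_contr.
  by rewrite big_split lerD ?HMx ?HMy.
(* all terms vanish off the support of [c], which is countable *)
have [code [dec [decK codeK]]] := countable_coding (countable_support c0 cM).
pose J : set (nat * I) := [set p | c p != 0].
pose reseq (z : l2_seq G) k : F :=
  if dec k is Some p then K p.2 (sval z p.1) else 0.
have reseq_l2 z : (forall p, `|K p.2 (sval z p.1)| ^+ 2 <= c p) ->
    square_summable (reseq z).
  move=> zc.
  have [|L HL] := @usums_exist _ _ g _ (fun k => `|reseq z k| ^+ 2) (Mx + My) g1.
    move=> t ut; apply: le_trans (cM (pmap dec t) (pmap_uniq decK ut)).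
    rewrite big_pmap; apply: ler_sum => k _; rewrite normrX normr_id /reseq.
    by case: (dec k) => [p|] /=; rewrite ?zc // normr0 expr0n.
  by apply/cvg_ex; exists L; exact: usums_nat_cvg.
have ux : square_summable (reseq x) by apply: reseq_l2 => p; rewrite lerDl exprn_ge0.
have uy : square_summable (reseq y) by apply: reseq_l2 => p; rewrite lerDr exprn_ge0.
exists (exist _ _ ux, exist _ _ uy) => T.
pose h (p : nat * I) := '[K p.2 (sval x p.1), T (K p.2 (sval y p.1))].
have [M M0 TM] := bop_bounded T.
have [|L HL] := @usums_exist _ _ g _ h (M * (Mx + My)) g1.
  move=> s us; rewrite (le_trans (ler_sum _ (fun p _ =>
    kraus_term_le (sval x p.1) (sval y p.1) (ltW M0) TM p.2))) //.
  by rewrite -mulr_sumr ler_pM2l // cM.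
have h0 p : ~ J p -> h p = 0.
  move=> /negP; rewrite negbK addr_eq0 => /eqP e.
  have : `|K p.2 (sval x p.1)| ^+ 2 == 0.
    by rewrite eq_le exprn_ge0 // andbT e oppr_le0 exprn_ge0.
  by rewrite expf_eq0 /= normr_eq0 => /eqP; rewrite /h => ->; rewrite inner0l.
have lim1 : limn (series (fun n => '[sval x n, Z T (sval y n)])) = L.
  apply: cvg_lim; first exact: norm_hausdorff.
  by apply: usums_nat_cvg; apply: usums_pair HL _ => n;
    exact: (HZ T (sval x n) (sval y n)).
have lim2 : limn (series (fun k => '[reseq x k, T (reseq y k)])) = L.
  apply: cvg_lim; first exact: norm_hausdorff.
  apply: usums_nat_cvg; apply: usums_ext (usums_reindex_nat decK codeK h0 HL) => k.
  by rewrite /reseq /h; case: (dec k) => //=; rewrite inner0l.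
by rewrite /sigma_weak_eval /= lim1 lim2.
Qed.

End KrausMap.

(** * Kraus operators below a completely positive map *)

Section KrausOperators.
Context {R : realType} {F G : hilbertType R}.
Local Notation C := R[i].
Variable A : set 'B(F).
Hypothesis hA : von_neumann_algebra A.

(** The squared seminorm, for the semi-inner product induced by [r] on the
    tensor product of operators and vectors, of the sum of the elementary
    tensors listed in [w]. *)
Definition gram (r : 'B(F) -> 'B(G)) (w : seq ('B(F) * G)) : C :=
  \sum_(p <- w) \sum_(q <- w) '[p.2, r (bop_mul (adj p.1) q.1) q.2].

Definition with_coefs (w : seq ('B(F) * G)) : Prop := forall p, p \in w -> A p.1.

(** Complete positivity of [r] on [A] in the form in which it is used. *)
Definition gram_positive (r : 'B(F) -> 'B(G)) : Prop :=
  forall w, with_coefs w -> 0 <= gram r w.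

(** Its squared norm is [gram] of the map [T |-> K^* T K] at [w]. *)
Definition kraus_vec (K : G -> F) (w : seq ('B(F) * G)) : F :=
  \sum_(p <- w) p.1 (K p.2).

Lemma vna_adj a : A a -> A (adj a).
Proof. by case: hA => _ _ _ + _ => adjA /adjA[b Ab /adj_unique <-]. Qed.

Lemma gram1 r a y : gram r [:: (a, y)] = '[y, r (bop_mul (adj a) a) y].
Proof. by rewrite /gram !big_seq1. Qed.

Lemma adj_one_mul (a : 'B(F)) : bop_mul (adj bop_one) a = a.
Proof. by rewrite adj_one; apply: bop_ext. Qed.

Lemma with_coefs1 a y : A a -> with_coefs [:: (a, y)].
Proof. by move=> Aa p; rewrite inE => /eqP ->. Qed.

(** The matrix of the products [a_i^* a_j] is positive. *)
Lemma cp_gram_positive S : completely_positive_on A S -> gram_positive S.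
Proof.
move=> cp w wA; pose p i := tnth (in_tuple w) i.
pose a : 'M['B(F)]_(size w) := \matrix_(i, j) bop_mul (adj (p i).1) (p j).1.
have pA i : A (p i).1 by apply: wA; exact: mem_tnth.
have aA i j : A (a i j) by rewrite mxE; apply: vna_mul => //; exact: vna_adj.
have apos : positive_bop_mx a.
  move=> x; have := inner_ge0 (\sum_i (p i).1 (x i)).
  move/(eq_ind _ (fun z => 0 <= z)); apply.
  rewrite inner_suml; apply: eq_bigr => i _.
  by rewrite inner_sumr; apply: eq_bigr => j _; rewrite mxE /= adjEr.
have := cp _ a aA apos (fun i => (p i).2); move/(eq_ind _ (fun z => 0 <= z)); apply.
apply: esym.
rewrite /gram big_tnth; apply: eq_bigr => i _.
by rewrite big_tnth; apply: eq_bigr => j _; rewrite !mxE.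
Qed.

(** Cauchy-Schwarz between an elementary tensor and an arbitrary one, for the
    semi-inner product that [r] induces on the tensor product of [A] and [G].
    It is the discriminant criterion for the Gram sums of [(a, t *: y) :: w]. *)
Lemma gram_cauchy_schwarz r a y w : gram_positive r -> A a -> with_coefs w ->
  \sum_(p <- w) '[p.2, r (bop_mul (adj p.1) a) y] =
    (\sum_(q <- w) '[y, r (bop_mul (adj a) q.1) q.2])^* /\
  `|\sum_(q <- w) '[y, r (bop_mul (adj a) q.1) q.2]| ^+ 2 <=
    '[y, r (bop_mul (adj a) a) y] * gram r w.
Proof.
move=> rpos Aa wA; apply: quadratic_psd.
- by rewrite -gram1; apply: rpos; exact: with_coefs1.
- exact: rpos.
move=> t; have := rpos ((a, t *: y) :: w) _.
have cw : with_coefs ((a, t *: y) :: w).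
  by move=> p; rewrite inE => /predU1P[->|/wA].
move=> /(_ cw); move/(eq_ind _ (fun z => 0 <= z)); apply.
rewrite /gram !big_cons /= bopZ innerZr innerZl.
rewrite (eq_bigr (fun q => t^* * '[y, r (bop_mul (adj a) q.1) q.2])); last first.
  by move=> q _; rewrite innerZl.
rewrite [X in _ + X](eq_bigr (fun p => t * '[p.2, r (bop_mul (adj p.1) a) y] +
  \sum_(q <- w) '[p.2, r (bop_mul (adj p.1) q.1) q.2])); last first.
  by move=> p _; rewrite big_cons /= bopZ innerZr.
by rewrite big_split /= -!mulr_sumr; ring.
Qed.

Variable f : F.
Hypothesis cyc : cyclic_vector A f.

(** Extraction of a Kraus operator [K] from a completely positive [r]: its
    adjoint sends [a f] to a multiple of [r a h].  Cauchy-Schwarz for [r] shows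
    that [r - K^* _ K] is still completely positive. *)
Lemma kraus_operator_below (r : 'B(F) -> 'B(G)) (h : G) (M : C) :
  (forall k a b, A a -> A b -> r (k *: a + b) = k *: r a + r b) ->
  gram_positive r -> 0 < M ->
  (forall a, A a -> '[h, r (bop_mul (adj a) a) h] <= M ^+ 2 * `|a f| ^+ 2) ->
  exists K : G -> F, [/\ linear K,
    forall a y, A a -> '[K y, a f] = M^-1 * '[y, r a h] &
    forall w, with_coefs w -> `|kraus_vec K w| ^+ 2 <= gram r w].
Proof.
move=> rL rpos M0 rM.
have A1 : A bop_one := vna_one hA.
have Mi0 : 0 <= M^-1 by rewrite invr_ge0 ltW.
(* Cauchy-Schwarz against the tensor of [1] and [y] bounds the functional *)
have /choice[K HK] y : exists u, forall a, A a -> '[u, a f] = M^-1 * '[y, r a h].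
  have q0 : 0 <= '[y, r bop_one y].
    by rewrite -[X in r X]adj_one_mul -gram1; apply: rpos; exact: with_coefs1.
  apply: (@riesz_along _ _ _ A (fun a : 'B(F) => a f) (fun a => M^-1 * '[y, r a h])
      (sqrtC '[y, r bop_one y])).
  - by have := vna_linear hA (-1) A1 A1; rewrite scaleN1r addNr.
  - by move=> k a b Aa Ab; exact: vna_linear.
  - by [].
  - by move=> k a b Aa Ab; rewrite rL // scale_bopE innerDr innerZr; ring.
  - by rewrite sqrtC_ge0.
  move=> a Aa; rewrite normrM ger0_norm // ler_pdivrMl // mulrCA.
  rewrite -ler_sqr ?nnegrE ?normr_ge0 ?mulr_ge0 ?sqrtC_ge0 ?(ltW M0) //.
  have [_] := @gram_cauchy_schwarz r bop_one y [:: (a, h)] rpos A1 (@with_coefs1 a h Aa).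
  rewrite big_seq1 /= !adj_one_mul gram1 => /le_trans; apply.
  rewrite exprMn sqrtCK ler_wpM2l // exprMn.
  exact: rM.
have Klin : linear K.
  move=> k x y; apply: (dense_inner_eq cyc) => _ [a Aa <-].
  by rewrite innerDl innerZl !HK // innerDl innerZl; ring.
exists K; split=> // [a y Aa|w wA]; first exact: HK.
have g0 := rpos w wA.
rewrite -[gram r w]sqrtCK ler_sqr ?nnegrE ?normr_ge0 ?sqrtC_ge0 //.
apply: (dense_norm_le cyc); rewrite ?sqrtC_ge0 // => _ [a Aa <-].
have [e cs] := gram_cauchy_schwarz h rpos Aa wA.
have -> : '[kraus_vec K w, a f] =
    M^-1 * \sum_(p <- w) '[p.2, r (bop_mul (adj p.1) a) h].
  rewrite inner_suml mulr_sumr !big_seq; apply: eq_bigr => p pw.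
  by rewrite -HK /= ?adjEr //; apply: vna_mul => //; apply/vna_adj/wA.
rewrite e normrM norm_conjC ger0_norm // ler_pdivrMl // mulrCA.
rewrite -ler_sqr ?nnegrE ?normr_ge0 ?mulr_ge0 ?sqrtC_ge0 ?(ltW M0) //.
by rewrite (le_trans cs) // exprMn sqrtCK mulrC ler_wpM2l // exprMn rM.
Qed.

End KrausOperators.

(** * Maximal families of Kraus operators *)

Section MaximalFamily.
Context {R : realType} {F G : hilbertType R}.
Local Notation C := R[i].
Variables (A : set 'B(F)) (S : 'B(F) -> 'B(G)).

(** The tag in [nat] lets the same operator occur several times. *)
Definition dominated_family (X : set (nat * (G -> F))) : Prop :=
  (forall i, X i -> linear i.2) /\
  forall w s, with_coefs A w -> uniq s -> (forall i, i \in s -> X i) ->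
    \sum_(i <- s) `|kraus_vec i.2 w| ^+ 2 <= gram S w.

(** Domination only involves finite parts of the family, so Zorn's lemma
    applies; it is used on the sets that are dominated after [i0] is added, so
    that the empty chain causes no difficulty. *)
Lemma maximal_dominated_family i0 : dominated_family [set i0] ->
  exists X, [/\ dominated_family X, X i0 &
    forall i, dominated_family (i |` X) -> X i].
Proof.
move=> dom0.
have [|X [domX maxX]] := @Zorn_bigcup _ [set X | dominated_family (i0 |` X)].
  move=> H HP tot; split=> [i [->|[X HX Xi]]|w s wA us].
  - by case: dom0 => + _; exact.
  - by have [+ _] := HP _ HX; apply; right.
  (* a finite part of the union of a chain lies in one of its members *)
  move=> sH; have [[X HX sX]|sX] : (exists2 X, H X & forall i, i \in s -> (i0 |` X) i) \/
      (forall i, i \in s -> i = i0).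
    elim: s {us} sH => [|i s IH] sH; first by right.
    have [i1 i1s|[X HX sX]|si0] := IH.
    - by apply: sH; rewrite inE i1s orbT.
    - left; have [->|[Y HY Yi]] := sH i (mem_head _ _).
        by exists X => // j; rewrite inE => /predU1P[->|/sX//]; left.
      have [XY|YX] := tot _ _ HX HY.
        exists Y => // j; rewrite inE => /predU1P[->|/sX[->|/XY]];
          [by right|by left|by right].
      exists X => // j; rewrite inE => /predU1P[->|/sX//]; right; exact: YX.
    have [->|[Y HY Yi]] := sH i (mem_head _ _).
      by right=> j; rewrite inE => /predU1P[->|/si0].
    by left; exists Y => // j; rewrite inE => /predU1P[->|/si0 ->]; [right|left].
  - by have [_] := HP _ HX; apply.
  - by have [_] := dom0; apply => // i /sX.
exists (i0 |` X); split=> // [|i domi]; first by left.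
have [->|ii0] := pselect (i = i0); first by left.
right; apply: contrapT => Xi; apply: (maxX (i |` X)) => /=; last by rewrite setUCA.
split=> [j|/(_ i)]; [by right|by move=> h; apply/Xi/h; left].
Qed.

End MaximalFamily.

(** * The extension *)

Section Extension.
Context {R : realType} {F G : hilbertType R}.
Local Notation C := R[i].
Variables (A : set 'B(F)) (B : set 'B(G)) (f : F) (g : G) (S : 'B(F) -> 'B(G)).
Hypothesis hA : von_neumann_algebra A.
Hypothesis f1 : `|f| = 1.
Hypothesis g1 : `|g| = 1.
Hypothesis hS : normal_ucp A B S.
Hypothesis hfg : forall a, A a -> vector_state f a = vector_state g (S a).
Hypothesis cyc : cyclic_vector A f.
Hypothesis cyc' : cyclic_vector (commutant B) g.

Let A1 : A bop_one := vna_one hA.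
Let A_adj_mul a b : A a -> A b -> A (bop_mul (adj a) b).
Proof. by move=> Aa Ab; apply: vna_mul => //; exact: vna_adj. Qed.

Let S_pos : gram_positive A S := cp_gram_positive hA (nucp_cp hS).

Let state_norm a : A a -> '[g, S (bop_mul (adj a) a) g] = `|a f| ^+ 2.
Proof.
move=> Aa; rewrite -[LHS]/(vector_state g _) -hfg; last exact: A_adj_mul.
by rewrite /vector_state /= adjEr norm_inner.
Qed.

Let gram_unit (r : 'B(F) -> 'B(G)) y : gram r [:: (bop_one, y)] = '[y, r bop_one y].
Proof. by rewrite gram1 adj_one_mul. Qed.

Let kraus_vec_unit (K : G -> F) y : kraus_vec K [:: (bop_one, y)] = K y.
Proof. by rewrite /kraus_vec big_seq1. Qed.

(** Here [S] itself is the residual and [h] is [g]: the bound needed is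
    [state_norm], an equality.  The formula for the adjoint of [K] reads
    [K g = f] after pairing with the dense vectors [a f]. *)
Let state_operator : exists K : G -> F,
  dominated_family A S [set (0%N, K)] /\ K g = f.
Proof.
have [|K [Klin HK Kdom]] := kraus_operator_below hA cyc (nucp_linear hS) S_pos
  (ltr01 : 0 < (1 : C)) (h := g).
  by move=> a Aa; rewrite expr1n mul1r state_norm.
exists K; split.
  split=> [i -> //|w s wA us sK].
  case: s us sK => [|i [|j s]] us sK; first by rewrite big_nil; exact: S_pos.
    by rewrite big_seq1 (sK i) ?inE //=; exact: Kdom.
  have ij : i = j.
    by rewrite [LHS](_ : i = (0%N, K)) ?[RHS](_ : j = (0%N, K)) //; apply: sK;
      rewrite !inE eqxx ?orbT.
  by move: us; rewrite ij /= inE eqxx.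
apply: (dense_inner_eq cyc) => _ [a Aa <-].
by rewrite HK // invr1 mul1r; have := hfg Aa.
Qed.

(** As [g] is cyclic for the commutant, some [r 1 (b g)] is nonzero, and since
    [b] commutes with the range of [S] the vector [b g] inherits from [g] the
    bound required of [h]. *)
Let residual_operator (r : 'B(F) -> 'B(G)) :
  (forall k a b, A a -> A b -> r (k *: a + b) = k *: r a + r b) ->
  gram_positive A r ->
  (forall a y, A a -> '[y, r (bop_mul (adj a) a) y] <= '[y, S (bop_mul (adj a) a) y]) ->
  r bop_one != 0 :> 'B(G) ->
  exists K : G -> F, [/\ linear K, exists y, K y != 0 &
    forall w, with_coefs A w -> `|kraus_vec K w| ^+ 2 <= gram r w].
Proof.
move=> rL rpos rS r1.
have [b [Bb rb]] : exists b, commutant B b /\ r bop_one (b g) != 0.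
  apply: contrapT => H; move/eqP: r1; apply.
  apply: bop_inner_ext => u y; rewrite [RHS]inner0r -adjE.
  suff -> : adj (r bop_one) u = 0 by rewrite inner0l.
  apply: (dense_inner_eq cyc') => _ [b Bb <-]; rewrite adjE inner0l.
  have [->|N0] := eqVneq (r bop_one (b g)) 0; first by rewrite inner0r.
  by exfalso; apply: H; exists b.
have [M M0 bM] := bop_bounded b.
have [|K [Klin HK Kdom]] := kraus_operator_below hA cyc rL rpos M0 (h := b g).
  move=> a Aa; rewrite (le_trans (rS _ _ Aa)) // -state_norm //.
  apply: commuting_form_le => //; first exact: ltW.
    by move=> x; rewrite -gram1; apply: S_pos; exact: with_coefs1.
  move=> x; have := Bb _ (nucp_to hS (A_adj_mul Aa Aa)).
  by move=> /(congr1 (fun T : 'B(G) => T x)).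
exists K; split=> //; exists (r bop_one (b g)); apply: contra_neq rb => K0.
have := HK _ (r bop_one (b g)) A1; rewrite K0 inner0l => /esym/eqP.
rewrite mulf_eq0 invr_eq0 gt_eqF //= => /eqP; exact: inner_eq0.
Qed.

(** The sum of a maximal dominated family through [K0].  The operator obtained
    from a nonzero residual could be added to the family; its tag is chosen
    fresh, which is possible because infinitely many copies of a nonzero
    operator are never dominated. *)
Lemma ucp_extension : exists Z : 'B(F) -> 'B(G),
  [/\ normal_ucp [set: 'B(F)] [set: 'B(G)] Z,
      forall a, A a -> Z a = S a &
      forall x, vector_state f x = vector_state g (Z x)].
Proof.
have [K0 [dom0 K0g]] := state_operator.
set i0 := (0%N, K0) in dom0.
have [X [[Xlin Xdom] Xi0 maxX]] := maximal_dominated_family dom0.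
pose K i : G -> F := if pselect (X i) then i.2 else fun=> 0.
have KX i : X i -> K i = i.2 by rewrite /K; case: pselect.
have KN i : ~ X i -> K i = fun=> 0 by rewrite /K; case: pselect.
have K_linear i : linear (K i).
  have [Xi|Xi] := pselect (X i); first by rewrite KX //; exact: Xlin.
  by rewrite KN // => k x y; rewrite scaler0 addr0.
have kraus0 i w : ~ X i -> kraus_vec (K i) w = 0.
  by move=> Xi; rewrite KN // /kraus_vec big1 // => p _; rewrite bop0.
have Kdom w s : with_coefs A w -> uniq s ->
    \sum_(i <- s) `|kraus_vec (K i) w| ^+ 2 <= gram S w.
  move=> wA us; rewrite (bigID (fun i => `[< X i >])) /= addrC big1 ?add0r; last first.
    by move=> i /asboolPn Xi; rewrite kraus0 // normr0 expr0n.
  rewrite -big_filter big_seq (eq_bigr (fun i => `|kraus_vec i.2 w| ^+ 2)); last first.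
    by move=> i; rewrite mem_filter => /andP[/asboolP Xi _]; rewrite KX.
  rewrite -big_seq; apply: Xdom => //; first exact: filter_uniq.
  by move=> i; rewrite mem_filter => /andP[/asboolP].
have w1 (y : G) : with_coefs A [:: (bop_one, y)] by exact: with_coefs1.
have K_contr y s : uniq s -> \sum_(i <- s) `|K i y| ^+ 2 <= `|y| ^+ 2.
  move=> us; have := Kdom _ _ (w1 y) us; rewrite gram_unit (nucp_unital hS) -norm_inner.
  by under eq_bigr do rewrite kraus_vec_unit.
have [Z HZ] := kraus_map_exists g1 K_linear K_contr.
have Z_linear := kraus_map_linear HZ.
have gramZ w : usums (fun i => `|kraus_vec (K i) w| ^+ 2) (gram Z w).
  have H : usums (fun i => \sum_(p <- w) \sum_(q <- w)
      '[K i p.2, bop_mul (adj p.1) q.1 (K i q.2)]) (gram Z w).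
    by apply: usums_sum => p; apply: usums_sum => q; exact: HZ.
  apply: usums_ext H => i; rewrite norm_inner inner_suml; apply: eq_bigr => p _.
  by rewrite inner_sumr; apply: eq_bigr => q _; rewrite /= adjEr.
pose r a := S a - Z a.
have rE a y x : '[y, r a x] = '[y, S a x] - '[y, Z a x].
  by rewrite -innerBr.
have gram_r w : gram r w = gram S w - gram Z w.
  rewrite /gram -sumrB; apply: eq_bigr => p _; rewrite -sumrB.
  by apply: eq_bigr => q _; rewrite rE.
have sq0 (x : F) : 0 <= `|x| ^+ 2 by rewrite exprn_ge0.
have gramZ0 w : 0 <= gram Z w by apply: (usums_ge0 (gramZ w)).
have r_pos : gram_positive A r.
  move=> w wA; rewrite gram_r subr_ge0 -[leLHS]ger0_norm //.
  apply: (usums_norm_le (gramZ w)) => s us.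
  by rewrite ger0_norm ?sumr_ge0 // Kdom.
have r_linear k a b : A a -> A b -> r (k *: a + b) = k *: r a + r b.
  move=> Aa Ab; rewrite /r (nucp_linear hS) // Z_linear scalerBr opprD.
  by rewrite addrACA.
have r_le_S a y : A a ->
    '[y, r (bop_mul (adj a) a) y] <= '[y, S (bop_mul (adj a) a) y].
  by move=> Aa; rewrite -!gram1 gram_r gerBl.
clearbody r.
(* by maximality the residual vanishes at the unit *)
have r1 : r bop_one = 0.
  have [//|/(residual_operator r_linear r_pos r_le_S)] := eqVneq (r bop_one) 0.
  move=> [L [Llin [y Ly] Ldom]]; exfalso.
  have [n Xn] : exists n, ~ X (n, L).
    apply: contrapT => /forallNP XL; move/negP: Ly; apply.
    have XL' k : X (k, L) by apply: contrapT; exact: XL.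
    suff : `|L y| ^+ 2 <= 0.
      move=> h; suff : `|L y| ^+ 2 == 0 by rewrite expf_eq0 /= normr_eq0.
      by rewrite eq_le h sq0.
    apply: (@natmul_bounded_le0 _ _ (`|y| ^+ 2)) => // n.
    have us : uniq [seq (k, L) | k <- iota 0 n].
      by rewrite map_inj_uniq ?iota_uniq // => ? ? [].
    have := K_contr y _ us; rewrite big_map.
    under eq_bigr do rewrite KX //=.
    by rewrite big_const_seq count_predT iter_addr_0 size_iota mulr_natl.
  apply: (Xn); apply: maxX; split=> [i [->//|/Xlin//]|w s wA us sX].
  have [Ls|Ls] := boolP ((n, L) \in s); last first.
    apply: Xdom => // i is_; have [E|//] := sX i is_.
    by rewrite -E is_ in Ls.
  rewrite (bigD1_seq (n, L)) //= -[gram S w](subrK (gram Z w)) -gram_r lerD ?Ldom //.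
  rewrite -big_filter; set t := [seq i <- s | i != (n, L)].
  have ut : uniq t by exact: filter_uniq.
  apply: le_trans (usums_ge (gramZ w) (fun i => sq0 _) ut).
  rewrite big_seq [leRHS]big_seq; apply: ler_sum => i.
  rewrite mem_filter => /andP[/eqP iN /sX[//|Xi]].
  by rewrite KX.
have ZS a : A a -> Z a = S a.
  move=> Aa; apply: bop_inner_ext => y x; apply/esym/eqP; rewrite -subr_eq0 -rE.
  have [_] := gram_cauchy_schwarz y r_pos A1 (with_coefs1 (A := A) (y := x) Aa).
  rewrite big_seq1 /= !adj_one_mul r1 inner0r mul0r => h.
  by rewrite -normr_eq0 -sqrf_eq0 eq_le h exprn_ge0.
exists Z; split=> //.
  split=> //.
  - by rewrite ZS // (nucp_unital hS).
  - exact: kraus_map_cp HZ.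
  - exact: kraus_map_normal g1 K_contr _ HZ.
have K0E : K i0 g = f by rewrite KX.
(* [K0 g] exhausts the norm of [g], so the other operators kill [g] *)
have Kg i : i != i0 -> K i g = 0.
  move=> ii0; have us : uniq [:: i0; i] by rewrite /= inE eq_sym ii0.
  have := K_contr g _ us; rewrite big_cons big_seq1 K0E f1 g1 expr1n gerDl => h.
  have : `|K i g| ^+ 2 == 0 by rewrite eq_le h sq0.
  by rewrite expf_eq0 /= normr_eq0 => /eqP.
move=> x; rewrite /vector_state -K0E.
apply: (usums_unique _ (HZ x g g)); apply: usums_single => i /Kg ->.
by rewrite inner0l.
Qed.

End Extension.

Theorem theorem4p11 (R : realType) (F G : hilbertType R)
    (A : set 'B(F)) (B : set 'B(G)) (f : F) (g : G) (S : 'B(F) -> 'B(G)) :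
  von_neumann_algebra A ->
  von_neumann_algebra B ->
  `|f| = 1 ->
  `|g| = 1 ->
  normal_ucp A B S ->
  (forall a, A a -> vector_state f a = vector_state g (S a)) ->
  cyclic_vector A f ->
  cyclic_vector (commutant B) g ->
  exists Z : 'B(F) -> 'B(G),
    [/\ normal_ucp [set: 'B(F)] [set: 'B(G)] Z,
        forall a, A a -> Z a = S a &
        forall x, vector_state f x = vector_state g (Z x)].
Proof.
move=> hA _ f1 g1 hS hfg cyc cyc'.
exact: ucp_extension hA f1 g1 hS hfg cyc cyc'.
Qed.
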